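(* Let $H\in\mathbb{C}^{M\times N}$ with $M\ge N$, let $E_s,N_0>0$, $\alpha=N_0/E_s$, and let $1\le\nu\le N-1$. Let $y=Hx+n$ where $x\sim\mathcal{CN}(0,E_sI_N)$ and $n\sim\mathcal{CN}(0,N_0I_M)$ are independent. For $F\in\mathbb{C}^{M\times N}$ and a Hermitian positive semidefinite $G\in\mathbb{C}^{N\times N}$ consider the mismatched detection model $$p_{\mathrm m}(y|x)=\exp\!\Big(2\,\mathrm{Re}\{y^\dagger F x\}-x^\dagger G x+\tfrac1{E_s}x^\dagger x\Big),\qquad p_{\mathrm m}(y)=\int_{\mathbb{C}^N}p_{\mathrm m}(y|x)\,p(x)\,dx,$$ where $p(x)=\frac{1}{\pi^NE_s^N}\exp(-\|x\|^2/E_s)$, and put $$I_{LB}(F,G)=\mathsf{E}_{Y,X}\big[\ln p_{\mathrm m}(y|x)\big]-\mathsf{E}_{Y}\big[\ln p_{\mathrm m}(y)\big].$$ Then, among all $F\in\mathbb{C}^{M\times N}$ and all positive semidefinite $G$ of the form $G=J^\dagger J$ with $J\in\mathbb{C}^{N\times N}$ having a punctured structure of order $\nu$, the optimal $F$ and $G$ that maximize $I_{LB}(F,G)$ are $$F^{\mathrm{opt}}=\mathbf{M}^\dagger G^{\mathrm{opt}},\qquad G^{\mathrm{opt}}=(J^{\mathrm{opt}})^\dagger J^{\mathrm{opt}},\qquad J^{\mathrm{opt}}=L_{ap},$$ where $\mathbf{M}=H^\dagger(HH^\dagger+\alpha I_M)^{-1}$ is the MMSE filter matrix and $L_{ap}$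 is the punctured augmented matrix of order $\nu$ associated with $H$ (defined in the context). Accordingly, the value $N\ln E_s+\ln\det(L_{ap}^\dagger L_{ap})$ attained by this choice is the maximum of $I_{LB}$.
   Context: $(\cdot)^\dagger$ is the conjugate transpose; $\mathcal{CN}$ is the circularly-symmetric complex Gaussian distribution; expectations are over the true joint law of $(x,y)$, with $H$ fixed. If $p_{\mathrm m}(y)=+\infty$ (which happens when $G$ is singular), $I_{LB}$ is understood as $-\infty$. $\mathrm{diag}(A)$ denotes the diagonal matrix with the same diagonal entries as $A$. Punctured structure of order $\nu$: $J=\begin{bmatrix} J_1 & 0 \\ J_2 & J_3 \end{bmatrix}$ with $J_1$ a $\nu\times\nu$ lower-triangular matrix, $J_2$ an arbitrary $(N-\nu)\times\nu$ complex matrix, and $J_3$ an $(N-\nu)\times(N-\nu)$ real diagonal matrix. Punctured augmented matrix: let $H_a=\begin{bmatrix} \frac1{\sqrt{N_0}}H \\ \frac1{\sqrt{E_s}}I_N \end{bmatrix}$ (size $(M+N)\times N$), and let $H_a=Q_aL_a$ be its thin QL decomposition: $Q_a$ is $(M+N)\times N$ with $Q_a^\dagger Q_a=I_N$, and $L_a$ is $N\times N$ lower triangular with real positive diagonal entries. Partition $L_a=\begin{bmatrix} P_a & 0 \\ R_a & S_a \end{bmatrix}$ with $P_a$ of size $\nu\times\nu$ and $S_a$ of size $(N-\nu)\times(N-\nu)$. Put $\Omega_a=\mathrm{diag}(S_a^{-1}S_a^{-\dagger})^{-1/2}$. Then $$L_{ap}=\begin{bmatrix} P_a & 0 \\ \Omega_aS_a^{-1}R_a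 & \Omega_a \end{bmatrix}.$$ *)

(* Defs.v *)
From HB Require Import structures.
From mathcomp Require Import all_boot all_order all_algebra.
From mathcomp Require Import complex.
From mathcomp Require Import all_classical all_reals all_analysis.

Set Implicit Arguments.
Unset Strict Implicit.
Unset Printing Implicit Defensive.
Import Order.TTheory GRing.Theory Num.Theory.
Import numFieldNormedType.Exports.

Local Open Scope classical_set_scope.
Local Open Scope ring_scope.
Local Open Scope complex_scope.
Local Open Scope sesquilinear_scope.

(* The n-fold product measure m^n on n.-tuple T, as the image of m \x m^(n-1)
   under cons. *)
Section power_measure.
Context d (T : measurableType d) (R : realType) (m : set T -> \bar R).

Definition tuple_cons n (p : T * n.-tuple T) : n.+1.-tuple T :=
  [tuple of p.1 :: p.2].

Fixpoint power_measure n : set (n.-tuple T) -> \bar R :=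
  if n is n'.+1
  then pushforward (m \x power_measure (n := n'))%E (@tuple_cons n')
  else \d_([tuple] : 0.-tuple T).

Lemma measurable_tuple_cons n : measurable_fun setT (@tuple_cons n).
Proof.
by apply: measurable_cons; [exact: measurable_fst|exact: measurable_snd].
Qed.
End power_measure.
Arguments power_measure {d T R} m n.

Lemma sigma_finite_product d1 d2 (T1 : measurableType d1)
    (T2 : measurableType d2) (R : realType)
    (m1 : {sigma_finite_measure set T1 -> \bar R})
    (m2 : {sigma_finite_measure set T2 -> \bar R}) :
  sigma_finite setT (m1 \x m2)%E.
Proof.
have /sigma_finiteP[F [TF ndF Foo]] := sigma_finiteT m1.
have /sigma_finiteP[G [TG ndG Goo]] := sigma_finiteT m2.
exists (fun n => F n `*` G n).
  rewrite -setXTT TF TG predeqE => -[x y]; split.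
    move=> [/= [n _ Fnx] [k _ Gky]]; exists (maxn n k) => //; split.
    - by move: x Fnx; exact/subsetPset/ndF/leq_maxl.
    - by move: y Gky; exact/subsetPset/ndG/leq_maxr.
  by move=> [n _ []/= ? ?]; split; exists n.
move=> k; have [? ?] := Foo k; have [? ?] := Goo k.
split; first exact: measurableX.
by rewrite product_measure1E// lte_mul_pinfty// ge0_fin_numE.
Qed.

Section power_measure_sigma_finite.
Context d (T : measurableType d) (R : realType).
Variable m : {sigma_finite_measure set T -> \bar R}.

Let power_measure_spec n :
  {mu : {sigma_finite_measure set (n.-tuple T) -> \bar R} |
    mu = power_measure m n :> (set (n.-tuple T) -> \bar R)}.
Proof.
elim: n => [|n [mu muE]].
  by exists (\d_([tuple] : 0.-tuple T) : {sigma_finite_measure set _ -> \bar R}).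
pose pc : {measure set (n.+1.-tuple T) -> \bar R} :=
  measure_function_pushforward__canonical__measure_function_Measure
    (m \x mu)%E (@measurable_tuple_cons _ T n).
have pcE : pc = power_measure m n.+1 :> (set _ -> _) by rewrite /= -muE.
pose uncons (t : n.+1.-tuple T) : T * n.-tuple T :=
  (thead t, [tuple of behead t]).
have consK : cancel (@tuple_cons _ T n) uncons.
  by move=> [x t]; rewrite /uncons theadE; congr pair; exact/val_inj.
have muncons : measurable_fun setT uncons.
  apply/measurable_fun_pairP; split; first exact: measurable_tnth.
  exact: measurable_behead.
have sf : sigma_finite setT pc.
  have [F FT Foo] := sigma_finite_product m mu.
  exists (fun k => uncons @^-1` F k); first by rewrite -preimage_bigcup -FT.
  move=> k; have [mF Fk] := Foo k; split.
    by rewrite -[X in measurable X]setTI; exact: muncons.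
  by rewrite /= /pushforward -comp_preimage (_ : _ \o _ = id)//; exact/funext.
pose B := Measure_isSigmaFinite.Build _ _ _ pc sf.
pose pc' : {sigma_finite_measure set (n.+1.-tuple T) -> \bar R} :=
  HB.pack (pc : set _ -> \bar R) (Measure.class pc) B.
by exists pc'.
Qed.

Let power_measure0 n : power_measure m n set0 = 0%E.
Proof. by have [mu <-] := power_measure_spec n; exact: measure0. Qed.

Let power_measure_ge0 n A : (0 <= power_measure m n A)%E.
Proof. by have [mu <-] := power_measure_spec n; exact: measure_ge0. Qed.

Let power_measure_sigma_additive n : semi_sigma_additive (power_measure m n).
Proof.
by have [mu <-] := power_measure_spec n; exact: measure_semi_sigma_additive.
Qed.

HB.instance Definition _ n := isMeasure.Build _ _ _ (power_measure m n)
  (power_measure0 n) (@power_measure_ge0 n) (@power_measure_sigma_additive n).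

Let power_measure_sigma_finite n : sigma_finite setT (power_measure m n).
Proof. by have [mu <-] := power_measure_spec n; exact: sigma_finiteT. Qed.

HB.instance Definition _ n := Measure_isSigmaFinite.Build _ _ _
  (power_measure m n) (power_measure_sigma_finite n).
End power_measure_sigma_finite.

Definition lebesgue_plane (R : realType) :
    set (measurableTypeR R * measurableTypeR R) -> \bar R :=
  (lebesgue_measure \x lebesgue_measure)%E.

HB.instance Definition _ (R : realType) := Measure.on (@lebesgue_plane R).
HB.instance Definition _ (R : realType) :=
  Measure_isSigmaFinite.Build _ _ _ (@lebesgue_plane R)
    (sigma_finite_product lebesgue_measure lebesgue_measure).

(* C^n, with the Borel sigma-algebra of R^(2n) pulled back along
   x |-> (Re x_i, Im x_i)_i. *)
Definition cvec (R : realType) (n : nat) := 'cV[R[i]]_n.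

Section cvec_measurable.
Context (R : realType) (n : nat).
Local Notation RR := (measurableTypeR R * measurableTypeR R)%type.

Definition tuple_of_cvec (x : cvec R n) : n.-tuple RR :=
  [tuple (complex.Re (x i 0), complex.Im (x i 0)) | i < n].

Definition cvec_of_tuple (t : n.-tuple RR) : cvec R n :=
  \col_i ((tnth t i).1 +i* (tnth t i).2).

HB.instance Definition _ := Choice.on (cvec R n).
HB.instance Definition _ := isPointed.Build (cvec R n) (0 : 'cV[R[i]]_n).
HB.instance Definition _ := @isMeasurable.Build (preimage_display tuple_of_cvec)
  (cvec R n) (g_sigma_algebra_preimage tuple_of_cvec)
  (@measurable0 _ (g_sigma_algebra_preimageType tuple_of_cvec))
  (@measurableC _ (g_sigma_algebra_preimageType tuple_of_cvec))
  (@bigcupT_measurable _ (g_sigma_algebra_preimageType tuple_of_cvec)).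

Lemma measurable_cvec_of_tuple : measurable_fun setT cvec_of_tuple.
Proof.
move=> _ _ [B mB <-]; rewrite !setTI -comp_preimage (_ : _ \o _ = id)//.
apply/funext => t; apply/eq_from_tnth => i /=.
by rewrite tnth_mktuple mxE /=; case: (tnth t i).
Qed.

Definition lebesgue_cvec : set (cvec R n) -> \bar R :=
  pushforward (power_measure (@lebesgue_plane R) n) cvec_of_tuple.

Let image_measure : {measure set (cvec R n) -> \bar R} :=
  measure_function_pushforward__canonical__measure_function_Measure
    (power_measure (@lebesgue_plane R) n) measurable_cvec_of_tuple.

Let lebesgue_cvec0 : lebesgue_cvec set0 = 0%E.
Proof. exact: (measure0 image_measure). Qed.

Let lebesgue_cvec_ge0 A : (0 <= lebesgue_cvec A)%E.
Proof. exact: (measure_ge0 image_measure). Qed.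

Let lebesgue_cvec_sigma_additive : semi_sigma_additive lebesgue_cvec.
Proof. exact: (@measure_semi_sigma_additive _ _ _ image_measure). Qed.

HB.instance Definition _ := isMeasure.Build _ _ _ lebesgue_cvec
  lebesgue_cvec0 lebesgue_cvec_ge0 lebesgue_cvec_sigma_additive.
End cvec_measurable.

Section detection.
Context (R : realType).
Local Notation C := R[i].

Definition sqnorm n (x : 'cV[C]_n) : R := complex.Re ((x^t* *m x) 0 0).

(* Density of CN(0, E I_n) with respect to lebesgue_cvec. *)
Definition cn_pdf n (E : R) (x : 'cV[C]_n) : R :=
  expR (- (sqnorm x / E)) / (pi ^+ n * E ^+ n).

Definition is_CN d (T : measurableType d) (P : probability T R) n
    (E : R) (X : {RV P >-> cvec R n}) : Prop :=
  forall A : set (cvec R n), measurable A ->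
    distribution P X A = (\int[@lebesgue_cvec R n]_(x in A) (cn_pdf E x)%:E)%E.

Definition independent_rv d (T : measurableType d) (P : probability T R)
    d1 d2 (T1 : measurableType d1) (T2 : measurableType d2)
    (X : {RV P >-> T1}) (Y : {RV P >-> T2}) : Prop :=
  forall A B, measurable A -> measurable B ->
    P (X @^-1` A `&` Y @^-1` B) = (P (X @^-1` A) * P (Y @^-1` B))%E.

Section mismatched_model.
Context (M N : nat) (Es : R) (F : 'M[C]_(M, N)) (G : 'M[C]_N).

(* x^t* G x is real for Hermitian G; its real part is taken only to land in R. *)
Definition pm_cond (y : 'cV[C]_M) (x : 'cV[C]_N) : R :=
  expR (2 * complex.Re ((y^t* *m F *m x) 0 0)
        - complex.Re ((x^t* *m G *m x) 0 0) + Es^-1 * sqnorm x).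

Definition pm (y : 'cV[C]_M) : \bar R :=
  (\int[@lebesgue_cvec R N]_x (pm_cond y x * cn_pdf Es x)%:E)%E.

(* If pm (Y w) = +oo for all w then, since lne +oo = +oo and a - +oo = -oo in
   \bar R, the value is -oo. *)
Definition I_LB d (T : measurableType d) (P : probability T R)
    (X : T -> cvec R N) (Y : T -> cvec R M) : \bar R :=
  (\int[P]_w (ln (pm_cond (Y w) (X w)))%:E - \int[P]_w lne (pm (Y w)))%E.

End mismatched_model.

Definition psdmx n (G : 'M[C]_n) : Prop :=
  G \is hermsymmx /\ forall x : 'cV[C]_n, 0 <= (x^t* *m G *m x) 0 0.

(* The order is nu and the size is nu + k. *)
Definition punctured nu k (J : 'M[C]_(nu + k)) : Prop :=
  exists (J1 : 'M[C]_nu) (J2 : 'M[C]_(k, nu)) (J3 : 'M[C]_k),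
    [/\ is_trig_mx J1, is_diag_mx J3, J3 \is a realmx
      & J = block_mx J1 0 J2 J3].

Definition feasible nu k (G : 'M[C]_(nu + k)) : Prop :=
  psdmx G /\ exists2 J : 'M[C]_(nu + k), punctured J & G = J^t* *m J.

Definition augmented_mx M N (H : 'M[C]_(M, N)) (Es N0 : R) : 'M[C]_(M + N, N) :=
  col_mx (((Num.sqrt N0)^-1)%:C *: H) (((Num.sqrt Es)^-1)%:C *: 1%:M).

Definition thin_QL m n (A Q : 'M[C]_(m, n)) (L : 'M[C]_n) : Prop :=
  [/\ A = Q *m L, Q^t* *m Q = 1%:M, is_trig_mx L & forall i, 0 < L i i].

(* diag(A)^(-1/2) *)
Definition diag_invsqrt n (A : 'M[C]_n) : 'M[C]_n :=
  diag_mx (\row_i (sqrtC (A i i))^-1).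

(* L_ap, as a function of the triangular factor L_a. *)
Definition punctured_augmented nu k (L : 'M[C]_(nu + k)) : 'M[C]_(nu + k) :=
  let S := drsubmx L in
  let Omega := diag_invsqrt (invmx S *m (invmx S)^t*) in
  block_mx (ulsubmx L) 0 (Omega *m invmx S *m dlsubmx L) Omega.

Definition mmse_filter M N (H : 'M[C]_(M, N)) (alpha : R) : 'M[C]_(N, M) :=
  H^t* *m invmx (H *m H^t* + (alpha%:C)%:M).

End detection.

(* Main.v *)
Require Import Defs.
From mathcomp Require Import all_boot all_order all_algebra.
From mathcomp Require Import complex.
From mathcomp Require Import all_classical all_reals all_analysis.
From mathcomp Require Import measurable_realfun ring lra zify.
Import Order.TTheory GRing.Theory Num.Theory.
Import numFieldNormedType.Exports.

Set Implicit Arguments.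
Unset Strict Implicit.
Unset Printing Implicit Defensive.

Local Open Scope classical_set_scope.
Local Open Scope ring_scope.
Local Open Scope complex_scope.
Local Open Scope sesquilinear_scope.

(* Write G = J^* J with J punctured, hence lower triangular. If J is singular
   then pm is +oo everywhere and I_LB = -oo. Otherwise completing the square
   in the Gaussian integral gives, with K = J^{-*} F^*,
     I_LB = N + N ln Es + ln |det J|^2 - E |J x - K y|^2,
   so F only enters through the linear estimate K y of J x. The mean square
   error is |J L_a^-1|^2 (Frobenius norm), reached exactly when K = J M, plus a
   nonnegative remainder. Finally J = B L_ap with B lower triangular and
   |J L_a^-1| = |B|, because the rows of L_ap L_a^-1 that meet the diagonal
   block are normalised by Omega_a; and ln |det B|^2 - |B|^2 <= - N with
   equality only for diagonal unitary B, i.e. G = L_ap^* L_ap. *)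

(** * Squared moduli and measurability *)

(** Integrals of exp(- |J x + b|^2) over C^N would in general call for a linear change of variables.
    Lower triangularity of J replaces it: the first entry of J x involves the first coordinate only,
    so Fubini and induction on the dimension reduce everything to integrals over one complex
    coordinate. Divergence for singular J comes out of the same induction. The law of (x, n) enters
    only through E |A x + B n|^2 = Es |A|^2 + N0 |B|^2; what remains is matrix algebra. The summand
    N of I_LB is E |x|^2 / Es. L_ap satisfies L_ap L_a^-1 = diag(1, Omega_a S_a^-1), whose lower
    block has unit rows. Puncturing makes the lower right block of B diagonal, and a diagonal matrix
    keeps its Frobenius norm when multiplied on the right by a matrix with unit rows. Maximality and
    uniqueness come from one identity: the gap to the optimum is (|B|^2 - ln |det B|^2 - N) plus the
    remainder of F, two nonnegative terms. *)

Section squared_modulus.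
Context (R : realType).
Local Notation C := R[i].

Definition nsq (z : C) : R := complex.Re z ^+ 2 + complex.Im z ^+ 2.

Lemma nsq_ge0 z : 0 <= nsq z.
Proof. by rewrite addr_ge0// sqr_ge0. Qed.

Lemma nsqM z w : nsq (z * w) = nsq z * nsq w.
Proof. by case: z w => [a b] [c d]; rewrite /nsq /=; ring. Qed.

Lemma nsq_eq0 z : (nsq z == 0) = (z == 0).
Proof. by rewrite eq_complex /nsq paddr_eq0 ?sqr_ge0// !sqrf_eq0. Qed.

Lemma nsq_gt0 z : (0 < nsq z) = (z != 0).
Proof. by rewrite lt0r nsq_ge0 andbT nsq_eq0. Qed.

Lemma nsq0 : nsq 0 = 0. Proof. by apply/eqP; rewrite nsq_eq0. Qed.

Lemma nsq1 : nsq 1 = 1. Proof. by rewrite /nsq /= expr1n expr0n addr0. Qed.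

Lemma nsqE z : (nsq z)%:C = Num.conj z * z.
Proof. by rewrite /nsq add_Re2_Im2 normCK mulrC. Qed.

Lemma sqnormE n (x : 'cV[C]_n) : sqnorm x = \sum_i nsq (x i 0).
Proof.
rewrite /sqnorm mxE raddf_sum; apply: eq_bigr => i _.
by rewrite !mxE -nsqE.
Qed.

Lemma sqnorm_ge0 n (x : 'cV[C]_n) : 0 <= sqnorm x.
Proof. by rewrite sqnormE sumr_ge0// => i _; exact: nsq_ge0. Qed.

Lemma sqnormEC n (x : 'cV[C]_n) : (sqnorm x)%:C = (x^t* *m x) 0 0.
Proof.
rewrite sqnormE rmorph_sum mxE; apply: eq_bigr => i _.
by rewrite !mxE; exact: nsqE.
Qed.

Lemma sqnorm_col n (x : 'cV[C]_1) (y : 'cV[C]_n) :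
  sqnorm (col_mx x y : 'cV_n.+1) = nsq (x 0 0) + sqnorm y.
Proof.
rewrite !sqnormE (@big_split_ord _ _ _ 1 n)/= big_ord1 (col_mxEu x y).
by under eq_bigr do rewrite (col_mxEd x y).
Qed.

End squared_modulus.

Section cvec_measurability.
Context (R : realType).
Local Notation C := R[i].
Local Notation RR := (measurableTypeR R * measurableTypeR R)%type.

Definition cmeasurable d (T : measurableType d) (f : T -> C) :=
  measurable_fun setT (fun t => complex.Re (f t)) /\
  measurable_fun setT (fun t => complex.Im (f t)).

Context d (T : measurableType d).
Implicit Types f g : T -> C.

Lemma cmeasurable_cst (a : C) : cmeasurable (fun _ : T => a).
Proof. by split; exact: measurable_cst. Qed.

Lemma cmeasurableD f g : cmeasurable f -> cmeasurable g ->
  cmeasurable (fun t => f t + g t).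
Proof.
move=> [f1 f2] [g1 g2]; split.
  by under eq_fun do rewrite raddfD; exact: measurable_funD.
by under eq_fun do rewrite raddfD; exact: measurable_funD.
Qed.

Lemma cmeasurableM f g : cmeasurable f -> cmeasurable g ->
  cmeasurable (fun t => f t * g t).
Proof.
move=> [f1 f2] [g1 g2]; split.
  rewrite [X in measurable_fun _ X](_ : _ = fun t =>
    complex.Re (f t) * complex.Re (g t) - complex.Im (f t) * complex.Im (g t)).
    by apply: measurable_funB; exact: measurable_funM.
  by apply/funext => t; case: (f t) (g t) => ? ? [].
rewrite [X in measurable_fun _ X](_ : _ = fun t =>
  complex.Re (f t) * complex.Im (g t) + complex.Im (f t) * complex.Re (g t)).
  by apply: measurable_funD; exact: measurable_funM.
by apply/funext => t; case: (f t) (g t) => ? ? [].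
Qed.

Lemma cmeasurable_sum (I : Type) (s : seq I) (f : I -> T -> C) :
  (forall i, cmeasurable (f i)) -> cmeasurable (fun t => \sum_(i <- s) f i t).
Proof.
move=> mf; elim: s => [|i s ih].
  by under [X in cmeasurable X]eq_fun do rewrite big_nil; exact: cmeasurable_cst.
by under [X in cmeasurable X]eq_fun do rewrite big_cons; exact: cmeasurableD.
Qed.

Lemma measurable_nsq f : cmeasurable f -> measurable_fun setT (fun t => nsq (f t)).
Proof.
by move=> [f1 f2]; apply: measurable_funD; exact: measurable_funX.
Qed.

(** The sigma-algebra of [cvec] is pulled back along [tuple_of_cvec], so a map into it is tested
    after composition with [tuple_of_cvec], and tuples are tested coordinatewise. *)
Lemma measurable_cvecP n (f : T -> cvec R n) :
  measurable_fun setT f <-> forall i, cmeasurable (fun t => f t i 0).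
Proof.
split=> [mf i|mf].
  have mt : measurable_fun setT (fun t => tnth (tuple_of_cvec (f t)) i).
    apply: (measurableT_comp (measurable_tnth i)).
    move=> _ B mB; rewrite setTI.
    have := mf measurableT (@tuple_of_cvec R n @^-1` B).
    rewrite setTI; apply; exists B => //; by rewrite setTI.
  split.
    have := measurableT_comp measurable_fst mt; congr measurable_fun.
    by apply/funext => t /=; rewrite tnth_mktuple.
  have := measurableT_comp measurable_snd mt; congr measurable_fun.
  by apply/funext => t /=; rewrite tnth_mktuple.
have mt : measurable_fun setT (fun t => tuple_of_cvec (f t)).
  apply/measurable_fun_tnthP => i.
  rewrite [X in measurable_fun _ X](_ : _ = fun t =>
     (complex.Re (f t i 0), complex.Im (f t i 0))); last first.
    by apply/funext => t /=; rewrite tnth_mktuple.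
  by have [? ?] := mf i; exact/measurable_fun_pair.
move=> _ _ [B mB <-]; rewrite !setTI.
by have := mt measurableT B mB; rewrite setTI.
Qed.

End cvec_measurability.

(** * Fubini for the Lebesgue measure of C^n *)

Section lebesgue_cvec_fubini.
Context (R : realType).
Local Notation C := R[i].
Local Notation RR := (measurableTypeR R * measurableTypeR R)%type.

Definition ccons n (z : RR) (t : cvec R n) : cvec R n.+1 :=
  col_mx (const_mx (z.1 +i* z.2) : 'cV_1) (t : 'cV_n).

Lemma cvec_of_tuple_cons n (z : RR) (t : n.-tuple RR) :
  cvec_of_tuple (tuple_cons (z, t)) = ccons z (cvec_of_tuple t).
Proof.
apply/colP => i; rewrite !mxE; case: splitP => j ij; rewrite !mxE.
  by rewrite !(tnth_nth (0, 0))/= ij ord1.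
by rewrite !(tnth_nth (0, 0))/= ij.
Qed.

Lemma cmeasurable_entry n (i : 'I_n) : cmeasurable (fun x : cvec R n => x i 0).
Proof. by have /measurable_cvecP := @measurable_id _ (cvec R n) setT; exact. Qed.

Lemma cmeasurable_pair d (T : measurableType d) (f g : T -> R) :
  measurable_fun setT f -> measurable_fun setT g ->
  cmeasurable (fun t => f t +i* g t).
Proof. by []. Qed.

Lemma measurable_ccons n :
  measurable_fun setT (fun p : RR * cvec R n => ccons p.1 p.2).
Proof.
apply/measurable_cvecP => i; under [X in cmeasurable X]eq_fun do rewrite mxE.
case: splitP => j _.
  under [X in cmeasurable X]eq_fun do rewrite mxE.
  apply: cmeasurable_pair.
    exact: (measurableT_comp measurable_fst measurable_fst).
  exact: (measurableT_comp measurable_snd measurable_fst).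
have [mRe mIm] := cmeasurable_entry j; split.
  exact: (measurableT_comp mRe measurable_snd).
exact: (measurableT_comp mIm measurable_snd).
Qed.

Lemma ge0_integral_cvec0 (f : cvec R 0 -> \bar R) : (forall x, 0 <= f x)%E ->
  measurable_fun setT f -> (\int[@lebesgue_cvec R 0]_x f x = f (0%R : 'cV[C]_0))%E.
Proof.
move=> f0 mf; rewrite /lebesgue_cvec ge0_integral_pushforward//; last first.
  exact: measurable_cvec_of_tuple.
rewrite preimage_setT /=.
rewrite integral_dirac//; last first.
  by apply: measurableT_comp => //; exact: measurable_cvec_of_tuple.
rewrite diracT mul1e /=; congr f; apply/colP => -[] //.
Qed.

(** The power measure is a pushforward along [tuple_cons], which [cvec_of_tuple] turns into [ccons];
    Tonelli then splits off the first coordinate. The inductions on the dimension rest on this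
    identity. *)
Lemma ge0_integral_cvecS n (f : cvec R n.+1 -> \bar R) : (forall x, 0 <= f x)%E ->
  measurable_fun setT f ->
  (\int[@lebesgue_cvec R n.+1]_x f x =
   \int[@lebesgue_plane R]_z \int[@lebesgue_cvec R n]_t f (ccons z t))%E.
Proof.
move=> f0 mf; rewrite {1}/lebesgue_cvec ge0_integral_pushforward//; last first.
  exact: measurable_cvec_of_tuple.
rewrite preimage_setT /=.
have mfc : measurable_fun setT (f \o @cvec_of_tuple R n.+1).
  by apply: measurableT_comp => //; exact: measurable_cvec_of_tuple.
rewrite ge0_integral_pushforward//=; last exact: measurable_tuple_cons.
rewrite preimage_setT fubini_tonelli1//=; last first.
  exact: (measurableT_comp mfc (@measurable_tuple_cons _ _ _)).
apply: eq_integral => z _; rewrite /fubini_F.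
rewrite /lebesgue_cvec ge0_integral_pushforward//; last 2 first.
- exact: measurable_cvec_of_tuple.
- have mz : measurable_fun setT (fun t : cvec R n => ccons z t).
    exact: (measurableT_comp (@measurable_ccons n) (pair1_measurable z)).
  exact: (measurableT_comp mf mz).
rewrite preimage_setT; apply: eq_integral => t _ /=.
by rewrite cvec_of_tuple_cons.
Qed.

End lebesgue_cvec_fubini.

(** * Gaussian integrals on the plane and on C^n *)

Section real_integrals.
Context d (T : measurableType d) (R : realType) (m : {measure set T -> \bar R}).
Implicit Types f g : T -> R.

Lemma ge0_integralZlR (k : R) f : 0 <= k -> (forall t, 0 <= f t) ->
  measurable_fun setT f ->
  (\int[m]_t (k * f t)%:E = k%:E * \int[m]_t (f t)%:E)%E.
Proof.
move=> k0 f0 mf; under eq_integral do rewrite EFinM.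
rewrite ge0_integralZl// => [|t _]; last by rewrite lee_fin.
exact/measurable_EFinP.
Qed.

Lemma ge0_integralDR f g : (forall t, 0 <= f t) -> (forall t, 0 <= g t) ->
  measurable_fun setT f -> measurable_fun setT g ->
  (\int[m]_t (f t + g t)%:E = \int[m]_t (f t)%:E + \int[m]_t (g t)%:E)%E.
Proof.
move=> f0 g0 mf mg; under eq_integral do rewrite EFinD.
by rewrite ge0_integralD//; do ?[exact/measurable_EFinP|move=> t _; rewrite lee_fin].
Qed.

End real_integrals.

Section plane_integrals.
Context (R : realType).
Local Notation C := R[i].
Local Notation RR := (measurableTypeR R * measurableTypeR R)%type.
Local Notation plane := (@lebesgue_plane R).
Local Notation mu := (@lebesgue_measure R).

Definition cpx (p : RR) : C := p.1 +i* p.2.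

Lemma cmeasurable_cpx : cmeasurable cpx.
Proof. by split; [exact: measurable_fst|exact: measurable_snd]. Qed.

Lemma cmeasurable_affine (a b : C) : cmeasurable (fun p => a * cpx p + b).
Proof.
apply: cmeasurableD; last exact: cmeasurable_cst.
by apply: cmeasurableM; [exact: cmeasurable_cst|exact: cmeasurable_cpx].
Qed.

Lemma integral_gauss_line (s p : R) : 0 < s ->
  (\int[mu]_u (expR (- (s * (u + p) ^+ 2)))%:E = (Num.sqrt (pi / s))%:E)%E.
Proof.
(* The integrand is an unnormalised normal density of mean [- p] and variance 1 / (2 s). *)
move=> s0; pose sg : R := (Num.sqrt (2 * s))^-1.
have s2 : sg ^+ 2 = (2 * s)^-1 by rewrite exprVn sqr_sqrtr// mulr_ge0// ltW.
have sg0 : sg != 0 by rewrite invr_eq0 sqrtr_eq0 -ltNge mulr_gt0.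
have peakE : normal_peak sg = (Num.sqrt (pi / s))^-1.
  rewrite /normal_peak s2; congr (Num.sqrt _)^-1.
  by rewrite -mulr_natr; field; rewrite gt_eqF.
have r0 : 0 < Num.sqrt (pi / s) by rewrite sqrtr_gt0 divr_gt0// pi_gt0.
transitivity (\int[mu]_u (Num.sqrt (pi / s) * normal_pdf (- p) sg u)%:E)%E.
  apply: eq_integral => u _; rewrite /normal_pdf (negbTE sg0)/= peakE.
  rewrite mulVKf ?gt_eqF// /normal_fun opprK s2.
  congr (expR _)%:E; rewrite -mulr_natr; field; rewrite gt_eqF//.
rewrite ge0_integralZlR ?(ltW r0)//.
- by rewrite integral_normal_pdf mule1.
- by move=> u; exact: normal_pdf_ge0.
- exact: measurable_normal_pdf.
Qed.

(** Factoring a z + b = a (z + b / a) turns the integrand into a product of two real Gaussians with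
    the same rate s = |a|^2, one per axis. *)
Lemma integral_gauss_plane (a b : C) : a != 0 ->
  (\int[plane]_p (expR (- nsq (a * cpx p + b)))%:E = (pi / nsq a)%:E)%E.
Proof.
move=> a0; have s0 : 0 < nsq a by rewrite nsq_gt0.
rewrite /lebesgue_plane fubini_tonelli1//=; last first.
  apply/measurable_EFinP; apply: measurableT_comp => //.
  apply: measurableT_comp => //; apply: measurable_nsq.
  exact: cmeasurable_affine.
pose q := b / a; set s := nsq a in s0 *.
have expE (u v : R) : expR (- nsq (a * (u +i* v) + b)) =
    expR (- (s * (u + complex.Re q) ^+ 2)) * expR (- (s * (v + complex.Im q) ^+ 2)).
  rewrite -expRD (_ : a * (u +i* v) + b = a * ((u +i* v) + q)); last first.
    by rewrite mulrDr /q mulrCA divff// mulr1.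
  by rewrite nsqM -/s; case: q => q1 q2; rewrite /nsq/=; congr expR; ring.
have mexp (p : R) : measurable_fun setT (fun u : R => expR (- (s * (u + p) ^+ 2))).
  apply: measurableT_comp => //; apply: measurableT_comp => //.
  by apply: measurable_funM => //; apply: measurable_funX; exact: measurable_funD.
transitivity (\int[mu]_u (Num.sqrt (pi / s) *
    expR (- (s * (u + complex.Re q) ^+ 2)))%:E)%E.
  apply: eq_integral => u _; rewrite /fubini_F.
  transitivity (\int[mu]_v (expR (- (s * (u + complex.Re q) ^+ 2)) *
      expR (- (s * (v + complex.Im q) ^+ 2)))%:E)%E.
    by apply: eq_integral => v _; rewrite expE.
  rewrite ge0_integralZlR ?expR_ge0//; last exact: mexp.
  by rewrite integral_gauss_line// -EFinM mulrC.
rewrite ge0_integralZlR ?sqrtr_ge0//; last exact: mexp.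
by rewrite integral_gauss_line// -EFinM -expr2 sqr_sqrtr// divr_ge0 ?pi_ge0// ltW.
Qed.

Lemma measurable_gauss (c : R) :
  measurable_fun setT (fun p : RR => expR (- (c * nsq (cpx p)))).
Proof.
apply: measurableT_comp => //; apply: measurableT_comp => //.
by apply: measurable_funM => //; apply: measurable_nsq; exact: cmeasurable_cpx.
Qed.

Lemma integral_gauss_plane0 (c : R) : 0 < c ->
  (\int[plane]_p (expR (- (c * nsq (cpx p))))%:E = (pi / c)%:E)%E.
Proof.
move=> c0; have sc0 : (Num.sqrt c)%:C != 0 :> C.
  by rewrite -nsq_gt0 /nsq/= expr0n addr0 sqr_sqrtr// ltW.
have nc : nsq (Num.sqrt c)%:C = c by rewrite /nsq/= expr0n addr0 sqr_sqrtr// ltW.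
rewrite -[in RHS]nc -(integral_gauss_plane 0)//; apply: eq_integral => p _.
by rewrite addr0 nsqM nc.
Qed.

(** One axis at a time: Lebesgue measure on the line is invariant under u |-> - u, and Tonelli
    carries this to the plane. *)
Lemma ge0_integral_planeN (f : RR -> \bar R) : (forall p, 0 <= f p)%E ->
  measurable_fun setT f ->
  (\int[plane]_p f (- p.1, - p.2)%R = \int[plane]_p f p)%E.
Proof.
have lineN (g : R -> \bar R) : (forall u, 0 <= g u)%E -> measurable_fun setT g ->
    (\int[mu]_u g (- u)%R = \int[mu]_u g u)%E.
  move=> g0 mg; rewrite -[RHS](@eq_measure_integral _ _ _ _ _
     (pushforward mu (-%R : _ -> measurableTypeR R))) => [|A mA _]; last first.
    exact: lebesgue_measureN.
  by rewrite ge0_integral_pushforward.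
move=> f0 mf; rewrite /lebesgue_plane fubini_tonelli1//=; last first.
  apply: (measurableT_comp mf); apply: measurable_fun_pair.
    by apply: measurableT_comp => //; exact: measurable_fst.
  by apply: measurableT_comp => //; exact: measurable_snd.
rewrite fubini_tonelli1// -(lineN (fubini_F mu f)).
- apply: eq_integral => u _; rewrite /fubini_F/=.
  rewrite -(lineN (fun v => f (- u, v)))//.
  exact: (measurableT_comp mf (pair1_measurable _)).
- by move=> u; apply: integral_ge0 => v _; exact: f0.
- exact: measurable_fun_fubini_tonelli_F.
Qed.

Lemma measurable_nsq_gauss (a b : C) (c : R) : measurable_fun setT
  (fun p : RR => nsq (a * cpx p + b) * expR (- (c * nsq (cpx p)))).
Proof.
apply: measurable_funM; last exact: measurable_gauss.
by apply: measurable_nsq; exact: cmeasurable_affine.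
Qed.

End plane_integrals.

Section plane_moments.
Context (R : realType).
Local Notation C := R[i].
Local Notation RR := (measurableTypeR R * measurableTypeR R)%type.
Local Notation plane := (@lebesgue_plane R).

(* [1 + t <= expR t] at [t = h * |z|^2] and [t = - h * |z|^2] squeezes the
   second moment between difference quotients of [pi / c]. *)
Lemma integral_nsq_gauss (c : R) : 0 < c ->
  (\int[plane]_p (nsq (cpx p) * expR (- (c * nsq (cpx p))))%:E =
   (pi / c ^+ 2)%:E)%E.
Proof.
move=> c0; set I := LHS.
have mq : measurable_fun setT (fun p : RR => nsq (cpx p)).
  by apply: measurable_nsq; exact: cmeasurable_cpx.
have mI : measurable_fun setT
    (fun p : RR => nsq (cpx p) * expR (- (c * nsq (cpx p)))).
  by apply: measurable_funM => //; exact: measurable_gauss.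
have f0 (p : RR) : 0 <= nsq (cpx p) * expR (- (c * nsq (cpx p))).
  by rewrite mulr_ge0 ?nsq_ge0 ?expR_ge0.
have e0 k (p : RR) : 0 <= expR (- (k * nsq (cpx p))) by exact: expR_ge0.
have mg k : measurable_fun setT (fun p : RR => expR (- (k * nsq (cpx p)))).
  exact: measurable_gauss.
have mhI h : measurable_fun setT
    (fun p : RR => h * (nsq (cpx p) * expR (- (c * nsq (cpx p))))).
  exact: measurable_funM.
have up h : 0 < h -> h < c -> (h%:E * I + (pi / c)%:E <= (pi / (c - h))%:E)%E.
  move=> h0 hc; have hf p : 0 <= h * (nsq (cpx p) * expR (- (c * nsq (cpx p)))).
    by rewrite mulr_ge0// ltW.
  rewrite -ge0_integralZlR ?(ltW h0)// -(integral_gauss_plane0 c0) -ge0_integralDR//.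
  rewrite -(@integral_gauss_plane0 _ (c - h)) ?subr_gt0//.
  apply: ge0_le_integral => //.
  - by move=> p _; rewrite lee_fin addr_ge0.
  - by apply/measurable_EFinP; exact: measurable_funD.
  - exact/measurable_EFinP.
  move=> p _; rewrite lee_fin (_ : - ((c - h) * _) =
    h * nsq (cpx p) + - (c * nsq (cpx p))); last by ring.
  rewrite expRD mulrA -{2}[expR (- _)]mul1r -mulrDl ler_wpM2r ?expR_ge0//.
  by rewrite addrC expR_ge1Dx.
have lo h : 0 < h -> ((pi / c)%:E <= (pi / (c + h))%:E + h%:E * I)%E.
  move=> h0; have hf p : 0 <= h * (nsq (cpx p) * expR (- (c * nsq (cpx p)))).
    by rewrite mulr_ge0// ltW.
  rewrite -ge0_integralZlR ?(ltW h0)// -(@integral_gauss_plane0 _ (c + h)) ?addr_gt0//.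
  rewrite -ge0_integralDR// -(integral_gauss_plane0 c0).
  apply: ge0_le_integral => //.
  - exact/measurable_EFinP.
  - by apply/measurable_EFinP; exact: measurable_funD.
  move=> p _; rewrite lee_fin (_ : - ((c + h) * _) =
    - (h * nsq (cpx p)) + - (c * nsq (cpx p))); last by ring.
  rewrite expRD mulrA -mulrDl -{1}[expR (- _)]mul1r ler_wpM2r ?expR_ge0//.
  by rewrite -lerBlDr expR_ge1Dx.
have I0 : (0 <= I)%E by apply: integral_ge0 => p _; rewrite lee_fin.
(* The bound [up] at h = c / 2 has a finite right-hand side, which excludes I = +oo. *)
have [r rE] : exists r, I = r%:E.
  have := up (c / 2) (divr_gt0 c0 (ltr0n _ 2)).
  rewrite ltr_pdivrMr// ltr_pMr// ltr1n => /(_ isT).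
  case: (I) I0 => [r _ _|_|//]; first by exists r.
  by rewrite gt0_muley ?lte_fin ?divr_gt0// addye.
have r0 : 0 <= r by rewrite -lee_fin -rE.
rewrite rE; congr EFin.
have c2 : 0 < c ^+ 2 by rewrite exprn_gt0.
apply/eqP; rewrite eq_le ler_pdivlMr// ler_pdivrMr//; apply/andP; split.
  apply/ler_addgt0Pr => e e0'.
  have rc1 : 0 < r * c + 1 by rewrite ltr_wpDl// mulr_ge0// ltW.
  (* h < c keeps the Gaussian of rate c - h integrable, and h r c <= e bounds the error; the [+ 1]
     keeps the denominator positive when r = 0. *)
  pose h := Num.min (c / 2) (e / (r * c + 1)).
  have h0 : 0 < h by rewrite lt_min !divr_gt0.
  have hc : h < c by rewrite gt_min ltr_pdivrMr// ltr_pMr// ltr1n.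
  have he : h * (r * c + 1) <= e by rewrite -ler_pdivlMr// ge_min lexx orbT.
  have := up _ h0 hc; rewrite rE -EFinM -EFinD lee_fin => H.
  have ch : 0 < c - h by rewrite subr_gt0.
  have : (h * r + pi / c) * (c * (c - h)) <= pi / (c - h) * (c * (c - h)).
    by rewrite ler_wpM2r// mulr_ge0// ltW.
  rewrite (_ : _ / (c - h) * _ = pi * c); last by field; rewrite gt_eqF.
  rewrite (_ : (_ + _) * _ = h * (r * c * (c - h)) + pi * (c - h)); last first.
    by field; rewrite gt_eqF.
  move=> {}H; have : h * (r * c * (c - h)) <= h * pi by nra.
  by rewrite ler_pM2l// => {}H; nra.
apply/ler_addgt0Pr => e e0'.
have rc1 : 0 < r * c + 1 by rewrite ltr_wpDl// mulr_ge0// ltW.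
pose h := e / (r * c + 1).
have h0 : 0 < h by rewrite divr_gt0.
have he : h * (r * c + 1) = e by rewrite divfK// gt_eqF.
have := lo _ h0; rewrite rE -EFinM -EFinD lee_fin => H.
have ch : 0 < c + h by rewrite addr_gt0.
have : pi / c * (c * (c + h)) <= (pi / (c + h) + h * r) * (c * (c + h)).
  by rewrite ler_wpM2r// mulr_ge0// ltW.
rewrite (_ : _ / c * _ = pi * (c + h)); last by field; rewrite gt_eqF.
rewrite (_ : (pi / (c + h) + _) * _ = h * (r * c * (c + h)) + pi * c); last first.
  by field; rewrite gt_eqF.
move=> {}H; have : h * pi <= h * (r * c * (c + h)) by nra.
by rewrite ler_pM2l// => {}H; nra.
Qed.

(* The reflection [z |-> - z] removes the cross term of [|a z + b|^2]. *)
Lemma integral_nsq_affine_gauss (a b : C) (c : R) : 0 < c ->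
  (\int[plane]_p (nsq (a * cpx p + b) * expR (- (c * nsq (cpx p))))%:E =
   (pi / c * (nsq a / c + nsq b))%:E)%E.
Proof.
move=> c0; set I := LHS.
pose f (p : RR) := nsq (a * cpx p + b) * expR (- (c * nsq (cpx p))).
have f0 p : 0 <= f p by rewrite mulr_ge0 ?nsq_ge0 ?expR_ge0.
have mf : measurable_fun setT f by exact: measurable_nsq_gauss.
have IN : I = (\int[plane]_p (f (- p.1, - p.2)%R)%:E)%E.
  by rewrite (ge0_integral_planeN (f := fun p => (f p)%:E))//; exact/measurable_EFinP.
have mfN : measurable_fun setT (fun p : RR => f (- p.1, - p.2)).
  apply: (measurableT_comp mf); apply: measurable_fun_pair.
    by apply: measurableT_comp => //; exact: measurable_fst.
  by apply: measurableT_comp => //; exact: measurable_snd.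
have : (I + I = (2 * (pi / c * (nsq a / c + nsq b)))%:E)%E.
  rewrite {2}IN -ge0_integralDR//.
  transitivity (\int[plane]_p (2 * nsq a *
      (nsq (cpx p) * expR (- (c * nsq (cpx p)))) +
      2 * nsq b * expR (- (c * nsq (cpx p))))%:E)%E.
    apply: eq_integral => p _; congr EFin; rewrite /f /nsq /cpx.
    case: (a) (b) => a1 a2 [b1 b2]; rewrite /= !sqrrN; ring.
  have n0 z : 0 <= 2 * nsq z by rewrite mulr_ge0 ?nsq_ge0.
  have mq : measurable_fun setT (fun p : RR => nsq (cpx p)).
    by apply: measurable_nsq; exact: cmeasurable_cpx.
  have mg := @measurable_gauss R c.
  have mqg : measurable_fun setT
      (fun p : RR => nsq (cpx p) * expR (- (c * nsq (cpx p)))).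
    exact: measurable_funM.
  have q0 (p : RR) : 0 <= nsq (cpx p) * expR (- (c * nsq (cpx p))).
    by rewrite mulr_ge0 ?nsq_ge0 ?expR_ge0.
  rewrite ge0_integralDR; last first.
  - exact: measurable_funM.
  - exact: measurable_funM.
  - by move=> p; rewrite mulr_ge0 ?n0 ?expR_ge0.
  - by move=> p; rewrite mulr_ge0 ?n0 ?q0.
  rewrite !ge0_integralZlR//.
  rewrite integral_nsq_gauss// integral_gauss_plane0// -!EFinM -EFinD.
  by congr EFin; field; rewrite gt_eqF.
have : (0 <= I)%E by apply: integral_ge0 => p _; rewrite lee_fin; exact: f0.
(* The finite value of I + I excludes I = +oo, so halving is legitimate. *)
case: (I) => [r _|//|//]; rewrite -EFinD => -[] rr; congr EFin; lra.
Qed.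

End plane_moments.

(** * Gaussian integrals on C^n with a triangular matrix *)

Section cvec_gauss_integrals.
Context (R : realType).
Local Notation C := R[i].
Local Notation RR := (measurableTypeR R * measurableTypeR R)%type.
Local Notation plane := (@lebesgue_plane R).
Local Notation mu := (@lebesgue_measure R).

Lemma lebesgue_planeT : plane setT = +oo%E.
Proof.
have muT : mu [set: measurableTypeR R] = +oo%E.
  have -> : [set: measurableTypeR R] = [set` `]-oo, +oo[] by rewrite set_itvNyy.
  by rewrite lebesgue_measure_itv.
rewrite /lebesgue_plane -setXTT product_measure1E//.
by transitivity (mu [set: measurableTypeR R] * mu [set: measurableTypeR R])%E;
  [|rewrite muT mulyy].
Qed.

(* Averaging over [z |-> - z] bounds the integrand below by a constant. *)
Lemma integral_expR_linear_plane (e : C) (k : R) :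
  (\int[plane]_p (expR (2 * complex.Re (e * cpx p) + k))%:E = +oo)%E.
Proof.
pose f (p : RR) := expR (2 * complex.Re (e * cpx p) + k).
have mRe : measurable_fun setT (fun p : RR => complex.Re (e * cpx p)).
  have := cmeasurable_affine e 0; under [X in cmeasurable X]eq_fun do rewrite addr0.
  by case.
have mf : measurable_fun setT f.
  apply: measurableT_comp => //; apply: measurable_funD => //.
  exact: measurable_funM.
have f0 p : 0 <= f p by exact: expR_ge0.
have mfN : measurable_fun setT (fun p : RR => f (- p.1, - p.2)).
  apply: (measurableT_comp mf); apply: measurable_fun_pair.
    by apply: measurableT_comp => //; exact: measurable_fst.
  by apply: measurableT_comp => //; exact: measurable_snd.
set I := LHS.
have IN : I = (\int[plane]_p (f (- p.1, - p.2)%R)%:E)%E.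
  by rewrite (ge0_integral_planeN (f := fun p => (f p)%:E))//; exact/measurable_EFinP.
have k0 : 0 < 2 * expR k by rewrite mulr_gt0// expR_gt0.
have : (+oo <= I + I)%E.
  rewrite [X in (_ <= _ + X)%E]IN -(ge0_integralDR _ f0 _ mf mfN)//.
  have <- : (\int[plane]_(p in setT) (cst (2 * expR k)%:E) p = +oo)%E.
    transitivity ((2 * expR k)%:E * +oo)%E; last by rewrite gt0_muley// lte_fin.
    by rewrite -lebesgue_planeT; exact: integral_cst.
  apply: ge0_le_integral; first exact: measurableT.
  - by move=> p _; rewrite lee_fin ltW.
  - exact: measurable_cst.
  - by apply/measurable_EFinP; exact: (measurable_funD mf mfN).
  move=> p _; rewrite lee_fin /f !expRD -mulrDl; apply: ler_wpM2r.
    exact: expR_ge0.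
  set x := 2 * _; rewrite (_ : 2 * complex.Re _ = - x); last first.
    by rewrite /x; case: (e) => e1 e2; rewrite /=; ring.
  (* Adding 1 + x <= expR x and 1 - x <= expR (- x) gives the constant 2 of the lower bound. *)
  have := expR_ge1Dx x; have := expR_ge1Dx (- x); move: (expR x) (expR (- x)).
  move=> *; lra.
have : (0 <= I)%E by apply: integral_ge0 => p _; rewrite lee_fin; exact: f0.
by case: (I).
Qed.

Section measurability.
Context d (T : measurableType d).

Lemma measurable_mulmx_cvec m n (A : 'M[C]_(m, n)) (f : T -> cvec R n) :
  measurable_fun setT f ->
  measurable_fun setT (fun t => A *m f t : cvec R m).
Proof.
move=> /measurable_cvecP mf; apply/measurable_cvecP => i.
under [X in cmeasurable X]eq_fun do rewrite mxE.
by apply: cmeasurable_sum => j; apply: cmeasurableM.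
Qed.

Lemma measurable_add_cvec n (f g : T -> cvec R n) :
  measurable_fun setT f -> measurable_fun setT g ->
  measurable_fun setT (fun t => (f t : 'cV[C]_n) + g t : cvec R n).
Proof.
move=> /measurable_cvecP mf /measurable_cvecP mg; apply/measurable_cvecP => i.
under [X in cmeasurable X]eq_fun do rewrite mxE.
exact: cmeasurableD.
Qed.

Lemma measurable_sqnorm n (f : T -> cvec R n) :
  measurable_fun setT f -> measurable_fun setT (fun t => sqnorm (f t)).
Proof.
move=> /measurable_cvecP mf; under eq_fun do rewrite sqnormE.
by apply: measurable_sum => i; exact: measurable_nsq.
Qed.

Lemma measurable_Re_mulmx n (u : 'rV[C]_n) (f : T -> cvec R n) :
  measurable_fun setT f ->
  measurable_fun setT (fun t => complex.Re ((u *m f t) 0 0)).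
Proof.
by move=> mf; have /measurable_cvecP/(_ 0)[] := measurable_mulmx_cvec u mf.
Qed.

End measurability.

Lemma measurable_affine_cvec m n (A : 'M[C]_(m, n)) (b : 'cV[C]_m) :
  measurable_fun setT (fun x : cvec R n => A *m x + b : cvec R m).
Proof.
apply: measurable_add_cvec; last exact: measurable_cst.
exact: measurable_mulmx_cvec.
Qed.

Lemma measurable_gauss_cvec n (u : 'rV[C]_n) (J : 'M[C]_n) (b : 'cV[C]_n) :
  measurable_fun setT (fun x : cvec R n =>
    expR (2 * complex.Re ((u *m x) 0 0) - sqnorm (J *m x + b))).
Proof.
apply: measurableT_comp => //; apply: measurable_funB.
  by apply: measurable_funM => //; exact: measurable_Re_mulmx.
by apply: measurable_sqnorm; exact: measurable_affine_cvec.
Qed.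

Lemma trig_mx_split n (J : 'M[C]_(1 + n)) : is_trig_mx J ->
  [/\ J = block_mx (ulsubmx J) 0 (dlsubmx J) (drsubmx J),
      is_trig_mx (drsubmx J)
    & \det J = ulsubmx J 0 0 * \det (drsubmx J)].
Proof.
move=> tJ; have := tJ; rewrite -{1}(submxK J) is_trig_block_mx//.
move=> /and3P[/eqP ur0 _ tdr].
have JE : J = block_mx (ulsubmx J) 0 (dlsubmx J) (drsubmx J).
  by rewrite -{1}(submxK J) ur0.
by split => //; rewrite {1}JE det_lblock det_mx11.
Qed.

(** The zero upper right block leaves the first coordinate alone in the first entry; on the other
    entries it acts as a translation, so the integral over [t] keeps its shape. *)
Lemma mul_block_ccons n (J1 : 'M[C]_1) (J2 : 'cV[C]_n) (J3 : 'M[C]_n)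
    (b : 'cV[C]_n.+1) (p : RR) (t : cvec R n) :
  sqnorm ((block_mx J1 0 J2 J3 : 'M[C]_n.+1) *m ccons p t + b) =
  nsq (J1 0 0 * cpx p + b 0 0) +
  sqnorm (J3 *m t + (J2 *m const_mx (cpx p) + dsubmx (b : 'cV[C]_(1 + n)))).
Proof.
have bE : b = col_mx (usubmx (b : 'cV[C]_(1 + n))) (dsubmx (b : 'cV[C]_(1 + n))).
  by rewrite vsubmxK.
rewrite /ccons (mul_block_col J1 0 J2 J3) mul0mx addr0.
rewrite [X in sqnorm X](_ : _ = col_mx (J1 *m const_mx (cpx p) +
    usubmx (b : 'cV[C]_(1 + n))) (J2 *m const_mx (cpx p) + J3 *m t +
    dsubmx (b : 'cV[C]_(1 + n)))); last by rewrite {1}bE; exact: add_col_mx.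
rewrite sqnorm_col; congr (_ + _); last first.
  by rewrite addrA [_ *m t + _]addrC.
by congr nsq; rewrite !mxE big_ord1 !mxE; congr (_ + b _ _); exact/val_inj.
Qed.

(** The value does not depend on the shift, so the integral over the remaining coordinates is, by
    induction, a constant factor of the integrand in the first one. *)
Lemma integral_gauss_cvec n (J : 'M[C]_n) (b : 'cV[C]_n) :
  is_trig_mx J -> \det J != 0 ->
  (\int[@lebesgue_cvec R n]_x (expR (- sqnorm (J *m x + b)))%:E =
   (pi ^+ n / nsq (\det J))%:E)%E.
Proof.
have mexp m (A : 'M[C]_m) c : measurable_fun setT
    (fun x : cvec R m => expR (- sqnorm (A *m x + c))).
  apply: measurableT_comp => //; apply: measurableT_comp => //.
  by apply: measurable_sqnorm; exact: measurable_affine_cvec.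
elim: n J b => [|n IH] J b tJ dJ.
  rewrite ge0_integral_cvec0//; last exact/measurable_EFinP.
  by rewrite sqnormE big_ord0 oppr0 expR0 det_mx00 nsq1 divr1 expr0.
have [JE tJ' dE] := trig_mx_split tJ.
move: dJ; rewrite dE mulf_eq0 negb_or => /andP[d1 d2].
rewrite ge0_integral_cvecS//; last exact/measurable_EFinP.
set a := ulsubmx _ 0 0 in d1 *; set J' := drsubmx _ in tJ' d2 *.
transitivity (\int[plane]_p (pi ^+ n / nsq (\det J') *
    expR (- nsq (a * cpx p + b 0 0)))%:E)%E.
  apply: eq_integral => p _.
  transitivity (\int[@lebesgue_cvec R n]_t (expR (- nsq (a * cpx p + b 0 0)) *
      expR (- sqnorm (J' *m t + (dlsubmx (J : 'M[C]_(1 + n)) *m const_mx (cpx p) +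
        dsubmx (b : 'cV[C]_(1 + n))))))%:E)%E.
    by apply: eq_integral => t _; rewrite {1}JE mul_block_ccons opprD expRD.
  rewrite ge0_integralZlR ?expR_ge0//.
  by rewrite IH// -EFinM mulrC.
rewrite ge0_integralZlR.
- rewrite integral_gauss_plane// -EFinM nsqM exprSr; congr EFin.
  by field; rewrite !nsq_eq0 d1 d2.
- by rewrite divr_ge0 ?nsq_ge0// exprn_ge0// pi_ge0.
- by move=> p; exact: expR_ge0.
- apply: measurableT_comp => //; apply: measurableT_comp => //.
  by apply: measurable_nsq; exact: cmeasurable_affine.
Qed.

(* Re(2 u v) - |v|^2 = |u|^2 - |v - u^*|^2 with v = J x + b. *)
Lemma integral_gauss_linear_cvec n (J : 'M[C]_n) (b : 'cV[C]_n) (u : 'rV[C]_n) :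
  is_trig_mx J -> \det J != 0 ->
  (\int[@lebesgue_cvec R n]_x
      (expR (2 * complex.Re ((u *m J *m x) 0 0) - sqnorm (J *m x + b)))%:E =
   (pi ^+ n / nsq (\det J) *
      expR (sqnorm (u^t*) - 2 * complex.Re ((u *m b) 0 0)))%:E)%E.
Proof.
move=> tJ dJ.
have sqB (v : 'cV[C]_n) : sqnorm (v - u^t*) =
    sqnorm v - 2 * complex.Re ((u *m v) 0 0) + sqnorm (u^t*).
  rewrite !sqnormE mxE raddf_sum mulr_sumr -sumrN -!big_split/=.
  apply: eq_bigr => i _; rewrite !mxE.
  by case: (u 0 i) (v i 0) => u1 u2 [v1 v2]; rewrite /nsq/=; ring.
pose k := expR (sqnorm (u^t*) - 2 * complex.Re ((u *m b) 0 0)).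
transitivity (\int[@lebesgue_cvec R n]_x
    (k * expR (- sqnorm (J *m x + (b - u^t*))))%:E)%E.
  apply: eq_integral => x _; rewrite addrA sqB /k -expRD; congr (expR _)%:E.
  by rewrite mulmxDr mulmxA [(_ *m x + _) 0 0]mxE raddfD/=; ring.
rewrite ge0_integralZlR ?expR_ge0//.
- by rewrite integral_gauss_cvec// -EFinM mulrC.
- apply: measurableT_comp => //; apply: measurableT_comp => //.
  by apply: measurable_sqnorm; exact: measurable_affine_cvec.
Qed.

(** The linear form [r] is arbitrary, since for singular J it need not factor as u J. If the
    trailing block is singular, the inner integral is +oo at every first coordinate. Otherwise the
    corner entry vanishes, no decay is left in the first coordinate, and integrating out the rest
    leaves the exponential of a real affine form, of infinite integral. *)
Lemma integral_gauss_cvec_singular n (J : 'M[C]_n) (b : 'cV[C]_n) (r : 'rV[C]_n) :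
  is_trig_mx J -> \det J = 0 ->
  (\int[@lebesgue_cvec R n]_x
    (expR (2 * complex.Re ((r *m x) 0 0) - sqnorm (J *m x + b)))%:E = +oo)%E.
Proof.
elim: n J b r => [|n IH] J b r tJ dJ.
  by move/eqP: dJ; rewrite det_mx00 oner_eq0.
have [JE tJ' dE] := trig_mx_split tJ.
rewrite ge0_integral_cvecS//; last first.
  by apply/measurable_EFinP; exact: measurable_gauss_cvec.
set a := ulsubmx _ 0 0 in dE; set J' := drsubmx _ in tJ' dE.
set c := dlsubmx (J : 'M[C]_(1 + n)) in JE.
set b' := dsubmx (b : 'cV[C]_(1 + n)).
set r0 := lsubmx (r : 'rV[C]_(1 + n)) 0 0; set r' := rsubmx (r : 'rV[C]_(1 + n)).
have innerE p : (\int[@lebesgue_cvec R n]_t (expR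
      (2 * complex.Re ((r *m ccons p t) 0 0) - sqnorm (J *m ccons p t + b)))%:E =
    (expR (2 * complex.Re (r0 * cpx p) - nsq (a * cpx p + b 0 0)))%:E *
    \int[@lebesgue_cvec R n]_t (expR (2 * complex.Re ((r' *m t) 0 0) -
      sqnorm (J' *m t + (c *m const_mx (cpx p) + b'))))%:E)%E.
  rewrite -ge0_integralZlR ?expR_ge0//; last exact: measurable_gauss_cvec.
  apply: eq_integral => t _; rewrite {1}JE mul_block_ccons -expRD.
  have -> : (r *m ccons p t) 0 0 = r0 * cpx p + (r' *m t) 0 0.
    rewrite -[r in LHS](hsubmxK (r : 'rV[C]_(1 + n))) /ccons.
    rewrite (mul_row_col (lsubmx (r : 'rV[C]_(1 + n)))) mxE; congr (_ + _).
    by rewrite [LHS]mxE big_ord1 [const_mx _ _ _]mxE.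
  by congr (expR _)%:E; rewrite raddfD/=; ring.
under eq_integral do rewrite innerE.
have [d'0|d'0] := eqVneq (\det J') 0.
  under eq_integral do rewrite IH// gt0_muley ?lte_fin ?expR_gt0//.
  transitivity (+oo * plane setT)%E; first exact: integral_cst.
  by rewrite lebesgue_planeT mulyy.
have a0 : a = 0.
  by move/eqP: dE; rewrite dJ eq_sym mulf_eq0 (negbTE d'0) orbF => /eqP.
(* Writing r' = u J' puts the inner integral in the form of [integral_gauss_linear_cvec]; [k] below
   gathers the terms free of p. *)
pose u := r' *m invmx J'.
have uJ : u *m J' = r' by rewrite mulmxKV// unitmxE unitfE.
pose k := sqnorm (u^t*) - nsq (b 0 0) - 2 * complex.Re ((u *m b') 0 0).
transitivity (\int[plane]_p (pi ^+ n / nsq (\det J') *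
    expR (2 * complex.Re ((r0 - (u *m c) 0 0) * cpx p) + k))%:E)%E.
  apply: eq_integral => p _; rewrite -uJ integral_gauss_linear_cvec// -EFinM.
  rewrite mulrCA -expRD a0 mul0r add0r; congr (_ * expR _)%:E.
  rewrite mulmxDr mulmxA [(_ + u *m b') 0 0]mxE mulrBl.
  have -> : (u *m c *m (const_mx (cpx p) : 'cV_1)) 0 0 = (u *m c) 0 0 * cpx p.
    by rewrite [LHS]mxE big_ord1 [const_mx _ _ _]mxE.
  have ReD (z w : C) : complex.Re (z + w) = complex.Re z + complex.Re w by case: z w => ? ? [].
  have ReN (z : C) : complex.Re (- z) = - complex.Re z by case: z.
  rewrite !ReD ReN /k.
  move: (complex.Re (r0 * _)) (complex.Re ((u *m c) 0 0 * _)) (nsq _) (sqnorm _).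
  by move: (complex.Re _) => *; ring.
rewrite ge0_integralZlR.
- rewrite integral_expR_linear_plane gt0_muley// lte_fin divr_gt0 ?nsq_gt0//.
  by rewrite exprn_gt0// pi_gt0.
- by rewrite divr_ge0 ?nsq_ge0// exprn_ge0// pi_ge0.
- by move=> p; exact: expR_ge0.
apply: measurableT_comp => //; apply: measurable_funD => //.
apply: measurable_funM => //.
have := cmeasurable_affine (r0 - (u *m c) 0 0) 0.
by under [X in cmeasurable X]eq_fun do rewrite addr0; case.
Qed.

End cvec_gauss_integrals.

(** * Moments of complex Gaussian vectors *)

Section density.
Context d (T : measurableType d) (R : realType).
Variables (mu nu : {measure set T -> \bar R}) (g : T -> R).
Hypotheses (g0 : forall x, 0 <= g x) (mg : measurable_fun setT g)
  (nuE : forall A, measurable A -> nu A = (\int[mu]_(x in A) (g x)%:E)%E).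

Import HBNNSimple.

(** The hypothesis [nuE] is the case of indicators; simple functions follow by linearity, and
    general [f] by monotone convergence on both sides. *)
Lemma ge0_integral_density (f : T -> \bar R) : (forall x, 0 <= f x)%E ->
  measurable_fun setT f ->
  (\int[nu]_x f x = \int[mu]_x (f x * (g x)%:E))%E.
Proof.
move=> f0 mf; pose h := nnsfun_approx measurableT mf.
have hf x : EFin \o h^~ x @ \oo --> f x by exact: cvg_nnsfun_approx.
have hnd x : {homo EFin \o h^~ x : a b / (a <= b)%N >-> (a <= b)%E}.
  by move=> a b ab; rewrite lee_fin; exact/lefP/nd_nnsfun_approx.
have mgE : measurable_fun setT (EFin \o g) by exact/measurable_EFinP.
transitivity (limn (fun n => \int[nu]_x (h n x)%:E)%E).
  rewrite -monotone_convergence//.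
  - by apply: eq_integral => x _; apply/esym/cvg_lim => //; exact: hf.
  - by move=> n; exact/measurable_EFinP.
  - by move=> n x _; rewrite lee_fin.
  - by move=> x _; exact: hnd.
transitivity (limn (fun n => \int[mu]_x ((h n x)%:E * (g x)%:E))%E); last first.
  rewrite -monotone_convergence//.
  - apply: eq_integral => x _; apply/cvg_lim => //.
    by apply: cvgeZr => //; exact: hf.
  - by move=> n; apply: emeasurable_funM => //; exact/measurable_EFinP.
  - by move=> n x _; rewrite mule_ge0 ?lee_fin.
  - by move=> x _ a b ab; rewrite lee_wpmul2r ?lee_fin//; exact/lefP/nd_nnsfun_approx.
congr (limn _); apply/funext => n.
have mind r : measurable_fun setT (fun x => (\1_(h n @^-1` [set r]) x)%:E : \bar R).
  exact/measurable_EFinP.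
transitivity (\sum_(r \in range (h n)) (r%:E * nu (h n @^-1` [set r])))%E.
  by rewrite integralT_nnsfun sintegralE.
transitivity (\int[mu]_x (\sum_(r \in range (h n))
    (r * \1_(h n @^-1` [set r]) x)%:E * (g x)%:E))%E; last first.
  apply: eq_integral => x _; rewrite [in RHS]fimfunE -fsumEFin//.
  by rewrite ge0_mule_fsuml// => r; exact: nnfun_muleindic_ge0.
rewrite ge0_integral_fsum//; last 2 first.
- move=> r; apply: emeasurable_funM => //; under eq_fun do rewrite EFinM.
  exact: measurable_funeM.
- move=> r x _; apply: mule_ge0; last by rewrite lee_fin.
  by rewrite EFinM; exact: nnfun_muleindic_ge0.
apply: eq_fsbigr => r /[!inE] -[x _ <-{r}].
under eq_integral do rewrite EFinM -muleA.
rewrite ge0_integralZl//.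
- congr (_ * _)%E; rewrite nuE//.
  rewrite [LHS]integral_mkcond; apply: eq_integral => y _.
  by rewrite epatch_indic muleC.
- exact: emeasurable_funM.
- by move=> y _; rewrite mule_ge0 ?lee_fin.
- by rewrite lee_fin.
Qed.

End density.

Section cn_moments.
Context (R : realType).
Local Notation C := R[i].
Local Notation RR := (measurableTypeR R * measurableTypeR R)%type.
Local Notation plane := (@lebesgue_plane R).

Lemma measurable_expR_sqnorm n (c : R) :
  measurable_fun setT (fun x : cvec R n => expR (- (c * sqnorm x))).
Proof.
apply: measurableT_comp => //; apply: measurableT_comp => //.
by apply: measurable_funM => //; exact: measurable_sqnorm.
Qed.

Lemma measurable_nsq_affine n (a : 'rV[C]_n) (b : C) :
  measurable_fun setT (fun x : cvec R n => nsq ((a *m x) 0 0 + b)).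
Proof.
apply: measurable_nsq; apply: cmeasurableD; last exact: cmeasurable_cst.
have := measurable_mulmx_cvec a (@measurable_id _ (cvec R n) setT).
by move=> /measurable_cvecP/(_ 0).
Qed.

(** The shift [b] makes the induction close: once the first coordinate z is split off, a_0 z + b is
    the shift of the remaining form. Up to the mass (pi / c)^n the value is the second moment |a|^2
    / c + |b|^2. *)
Lemma integral_nsq_expR_sqnorm n (a : 'rV[C]_n) (b : C) (c : R) : 0 < c ->
  (\int[@lebesgue_cvec R n]_x
     (nsq ((a *m x) 0 0 + b) * expR (- (c * sqnorm x)))%:E =
   ((pi / c) ^+ n * ((\sum_j nsq (a 0 j)) / c + nsq b))%:E)%E.
Proof.
move=> c0.
have mf m (a' : 'rV[C]_m) b' : measurable_fun setT (fun x : cvec R m =>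
    nsq ((a' *m x) 0 0 + b') * expR (- (c * sqnorm x))).
  apply: measurable_funM; first exact: measurable_nsq_affine.
  exact: measurable_expR_sqnorm.
have f0 m (a' : 'rV[C]_m) b' (x : cvec R m) :
    0 <= nsq ((a' *m x) 0 0 + b') * expR (- (c * sqnorm x)).
  by rewrite mulr_ge0 ?nsq_ge0 ?expR_ge0.
elim: n a b => [|n IH] a b.
  rewrite ge0_integral_cvec0.
  - rewrite mulmx0 mxE sqnormE !big_ord0 mulr0 oppr0 expR0 mulr1 add0r mul0r.
    by rewrite add0r expr0 mul1r.
  - by move=> x; rewrite lee_fin.
  - exact/measurable_EFinP.
rewrite ge0_integral_cvecS; first last.
- exact/measurable_EFinP.
- by move=> x; rewrite lee_fin.
set a0 := lsubmx (a : 'rV[C]_(1 + n)) 0 0; set a' := rsubmx (a : 'rV[C]_(1 + n)).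
pose s := (\sum_j nsq (a' 0 j)) / c.
have s0 : 0 <= s by rewrite divr_ge0 ?(ltW c0)// sumr_ge0// => j _; exact: nsq_ge0.
have pc0 m : 0 <= (pi / c : R) ^+ m by rewrite exprn_ge0// divr_ge0 ?pi_ge0// ltW.
have asum : \sum_j nsq (a 0 j) = nsq a0 + \sum_j nsq (a' 0 j).
  rewrite (@big_split_ord _ _ _ 1 n)/= big_ord1; congr (nsq _ + _).
    by rewrite /a0 mxE.
  by apply: eq_bigr => j _; rewrite /a' mxE.
transitivity (\int[plane]_p (((pi / c) ^+ n * s) * expR (- (c * nsq (cpx p))) +
   (pi / c) ^+ n * (nsq (a0 * cpx p + b) * expR (- (c * nsq (cpx p)))))%:E)%E.
  apply: eq_integral => p _.
  transitivity (\int[@lebesgue_cvec R n]_t (expR (- (c * nsq (cpx p))) *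
      (nsq ((a' *m t) 0 0 + (a0 * cpx p + b)) * expR (- (c * sqnorm t))))%:E)%E.
    apply: eq_integral => t _.
    have -> : (a *m ccons p t) 0 0 = a0 * cpx p + (a' *m t) 0 0.
      rewrite -[a in LHS](hsubmxK (a : 'rV[C]_(1 + n))) /ccons.
      rewrite (mul_row_col (lsubmx (a : 'rV[C]_(1 + n)))) mxE; congr (_ + _).
      by rewrite [LHS]mxE big_ord1 [const_mx _ _ _]mxE.
    rewrite /ccons sqnorm_col [const_mx _ _ _]mxE mulrDr opprD expRD; congr EFin.
    by rewrite -addrA addrCA; ring.
  rewrite ge0_integralZlR ?expR_ge0//.
  by rewrite IH -EFinM -/s; congr EFin; ring.
have mg := @measurable_gauss R c.
have mq := measurable_nsq_gauss a0 b c.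
rewrite ge0_integralDR; first last.
- exact: measurable_funM.
- exact: measurable_funM.
- move=> p; apply: mulr_ge0; first exact: pc0.
  by rewrite mulr_ge0 ?nsq_ge0 ?expR_ge0.
- by move=> p; apply: mulr_ge0; [exact: mulr_ge0|exact: expR_ge0].
have pcs0 : 0 <= (pi / c) ^+ n * s by apply: mulr_ge0; first exact: pc0.
have e0 (p : RR) : 0 <= expR (- (c * nsq (cpx p))) by exact: expR_ge0.
rewrite (ge0_integralZlR _ pcs0 e0 mg) ge0_integralZlR.
- rewrite integral_gauss_plane0// integral_nsq_affine_gauss// -!EFinM -EFinD.
  by rewrite asum /s exprS; congr EFin; field; rewrite gt_eqF.
- exact: pc0.
- by move=> p; rewrite mulr_ge0 ?nsq_ge0 ?expR_ge0.
- exact: mq.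
Qed.

Lemma cn_pdfE n (E : R) (x : 'cV[C]_n) : 0 < E ->
  cn_pdf E x = (pi * E) ^- n * expR (- (E^-1 * sqnorm x)).
Proof. by move=> E0; rewrite /cn_pdf exprMn mulrC [sqnorm x / E]mulrC. Qed.

Lemma cn_pdf_ge0 n (E : R) (x : 'cV[C]_n) : 0 < E -> 0 <= cn_pdf E x.
Proof.
move=> E0; rewrite cn_pdfE// mulr_ge0 ?expR_ge0// invr_ge0 exprn_ge0//.
by rewrite mulr_ge0 ?pi_ge0// ltW.
Qed.

Lemma measurable_cn_pdf n (E : R) : 0 < E ->
  measurable_fun setT (fun x : cvec R n => cn_pdf E x).
Proof.
move=> E0; under eq_fun do rewrite cn_pdfE//.
by apply: measurable_funM => //; exact: measurable_expR_sqnorm.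
Qed.

Lemma integral_nsq_CN d (T : measurableType d) (P : probability T R) n (E : R)
    (X : {RV P >-> cvec R n}) (a : 'rV[C]_n) (b : C) : 0 < E -> is_CN E X ->
  (\int[distribution P X]_x (nsq ((a *m x) 0 0 + b))%:E =
   (E * (\sum_j nsq (a 0 j)) + nsq b)%:E)%E.
Proof.
move=> E0 XE.
rewrite (@ge0_integral_density _ (cvec R n) R (@lebesgue_cvec R n)
  (distribution P X) (fun x => cn_pdf E x)) => //.
- transitivity (\int[@lebesgue_cvec R n]_x ((pi * E) ^- n *
      (nsq ((a *m x) 0 0 + b) * expR (- (E^-1 * sqnorm x))))%:E)%E.
    by apply: eq_integral => x _; rewrite -EFinM cn_pdfE//; congr EFin; ring.
  have pE : 0 < (pi * E) ^+ n by rewrite exprn_gt0// mulr_gt0 ?pi_gt0.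
  rewrite ge0_integralZlR.
  + rewrite integral_nsq_expR_sqnorm ?invr_gt0// -EFinM invrK; congr EFin.
    by field; rewrite gt_eqF.
  + by rewrite invr_ge0 ltW.
  + by move=> x; rewrite mulr_ge0 ?nsq_ge0 ?expR_ge0.
  + by apply: measurable_funM; [exact: measurable_nsq_affine|exact: measurable_expR_sqnorm].
- by move=> x; exact: cn_pdf_ge0.
- exact: measurable_cn_pdf.
- by move=> x; rewrite lee_fin nsq_ge0.
- by apply/measurable_EFinP; exact: measurable_nsq_affine.
Qed.

End cn_moments.

Section joint_moments.
Context (R : realType).
Local Notation C := R[i].

(** This is the square of the Frobenius norm, not the norm itself. *)
Definition frob m n (A : 'M[C]_(m, n)) : R := \sum_i \sum_j nsq (A i j).

(** Under independence the law of the pair agrees with the product of the two laws on rectangles,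
    which determine a product measure; Tonelli then applies. *)
Lemma ge0_integral_independent d (T : measurableType d) (P : probability T R)
    d1 d2 (T1 : measurableType d1) (T2 : measurableType d2)
    (X : {RV P >-> T1}) (Y : {RV P >-> T2}) (f : T1 * T2 -> \bar R) :
  independent_rv X Y -> (forall z, 0 <= f z)%E -> measurable_fun setT f ->
  (\int[P]_w f (X w, Y w) =
   \int[distribution P X]_x \int[distribution P Y]_y f (x, y))%E.
Proof.
move=> XY f0 mf; pose Z w := (X w, Y w).
have mZ : measurable_fun setT Z by exact: measurable_fun_pair.
pose PZ : {measure set (T1 * T2) -> \bar R} :=
  measure_function_pushforward__canonical__measure_function_Measure P mZ.
transitivity (\int[PZ]_z f z)%E; first by rewrite ge0_integral_pushforward.
rewrite -(fubini_tonelli1 f)//; apply: eq_measure_integral => A mA _.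
by apply/esym/product_measure_unique => // B D mB mD; exact: XY.
Qed.

Context d (T : measurableType d) (P : probability T R) (n m : nat) (E1 E2 : R)
  (X : {RV P >-> cvec R n}) (W : {RV P >-> cvec R m}).
Hypotheses (E1_gt0 : 0 < E1) (E2_gt0 : 0 < E2)
  (XE : is_CN E1 X) (WE : is_CN E2 W) (XW : independent_rv X W).

Let cmeasurable_row (k l : nat) (a : 'rV[C]_k) d' (T' : measurableType d')
  (f : T' -> cvec R k) : measurable_fun setT f ->
  cmeasurable (fun t => (a *m f t) 0 0).
Proof. by move=> /(measurable_mulmx_cvec a)/measurable_cvecP/(_ 0). Qed.

(** Integrating over W first, with a x as a constant shift, and then over X yields the two variances
    without any cross term to treat. *)
Lemma integral_nsq_joint_CN (a : 'rV[C]_n) (b : 'rV[C]_m) :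
  (\int[P]_w (nsq ((a *m X w) 0 0 + (b *m W w) 0 0))%:E =
   (E1 * (\sum_j nsq (a 0 j)) + E2 * (\sum_j nsq (b 0 j)))%:E)%E.
Proof.
have mf : measurable_fun setT (fun z : cvec R n * cvec R m =>
    nsq ((a *m z.1) 0 0 + (b *m z.2) 0 0)).
  apply: measurable_nsq; apply: cmeasurableD.
    exact: cmeasurable_row measurable_fst.
  exact: cmeasurable_row measurable_snd.
rewrite (ge0_integral_independent (f := fun z : cvec R n * cvec R m =>
  (nsq ((a *m z.1) 0 0 + (b *m z.2) 0 0))%:E) XW); first last.
- exact/measurable_EFinP.
- by move=> z; rewrite lee_fin nsq_ge0.
pose K := E2 * (\sum_j nsq (b 0 j)).
have K0 : 0 <= K.
  by rewrite mulr_ge0 ?(ltW E2_gt0)// sumr_ge0// => j _; exact: nsq_ge0.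
transitivity (\int[distribution P X]_x (K + nsq ((a *m x) 0 0 + 0))%:E)%E.
  apply: eq_integral => x _ /=; rewrite addr0 /K -(integral_nsq_CN _ _ E2_gt0 WE).
  by apply: eq_integral => y _; rewrite addrC.
rewrite ge0_integralDR.
- rewrite (integral_nsq_CN _ _ E1_gt0 XE) nsq0 addr0.
  transitivity (K%:E * distribution P X setT + (E1 * (\sum_j nsq (a 0 j)))%:E)%E.
    by congr (_ + _)%E; exact: integral_cst.
  by rewrite probability_setT mule1 -EFinD addrC.
- by [].
- by move=> x; exact: nsq_ge0.
- exact: measurable_cst.
- exact: measurable_nsq_affine.
Qed.

Lemma integral_sqnorm_joint_CN p (A : 'M[C]_(p, n)) (B : 'M[C]_(p, m)) :
  (\int[P]_w (sqnorm (A *m X w + B *m W w))%:E =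
   (E1 * frob A + E2 * frob B)%:E)%E.
Proof.
have entryE (i : 'I_p) w : (A *m X w + B *m W w) i 0 =
    (row i A *m X w) 0 0 + (row i B *m W w) 0 0.
  by rewrite -!row_mul [in RHS]mxE [in X in _ = _ + X]mxE mxE.
transitivity (\int[P]_w \sum_(i < p)
    (nsq ((row i A *m X w) 0 0 + (row i B *m W w) 0 0))%:E)%E.
  apply: eq_integral => w _; rewrite sqnormE sumEFin; congr EFin.
  by apply: eq_bigr => i _; rewrite entryE.
rewrite ge0_integral_sum//.
- under eq_bigr do rewrite integral_nsq_joint_CN.
  rewrite sumEFin big_split/= -!mulr_sumr; congr EFin.
  by congr (_ * _ + _ * _); apply: eq_bigr => i _; apply: eq_bigr => j _;
    rewrite mxE.
- move=> i; apply/measurable_EFinP; apply: measurable_nsq.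
  by apply: cmeasurableD; exact: cmeasurable_row.
- by move=> i w _; rewrite lee_fin nsq_ge0.
Qed.

Lemma integrable_sqnorm_joint_CN p (A : 'M[C]_(p, n)) (B : 'M[C]_(p, m)) :
  P.-integrable setT (fun w => (sqnorm (A *m X w + B *m W w))%:E).
Proof.
apply/integrableP; split.
  apply/measurable_EFinP; apply: measurable_sqnorm; apply: measurable_add_cvec;
    exact: measurable_mulmx_cvec.
under eq_integral do rewrite gee0_abs ?lee_fin ?sqnorm_ge0//.
by rewrite integral_sqnorm_joint_CN ltry.
Qed.

End joint_moments.

(** * The mutual information bound of a mismatched model *)

Section finite_expectation.
Context d (T : measurableType d) (R : realType) (P : probability T R).

(** Integrability travels with the value because the expectations combined below have terms of both
    signs, and additivity of the integral then relies on it. *)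
Definition has_mean (f : T -> R) (v : R) :=
  P.-integrable setT (fun w => (f w)%:E) /\ (\int[P]_w (f w)%:E = v%:E)%E.

Lemma has_meanD f g u v : has_mean f u -> has_mean g v ->
  has_mean (fun w => f w + g w) (u + v).
Proof.
move=> [fi fE] [gi gE]; split.
  by under eq_fun do rewrite EFinD; exact: integrableD.
by under eq_integral do rewrite EFinD; rewrite integralD// fE gE.
Qed.

Lemma has_meanZ k f u : has_mean f u -> has_mean (fun w => k * f w) (k * u).
Proof.
move=> [fi fE]; split.
  by under eq_fun do rewrite EFinM; exact: integrableZl.
by under eq_integral do rewrite EFinM; rewrite integralZl// fE.
Qed.

Lemma has_mean_cst k : has_mean (fun=> k) k.
Proof.
split; first exact: finite_measure_integrable_cst.
by transitivity (k%:E * P setT)%E;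
  [exact: integral_cst|rewrite probability_setT mule1].
Qed.

End finite_expectation.

Section mutual_information_bound.
Context (R : realType).
Local Notation C := R[i].

Lemma adjM m n p (A : 'M[C]_(m, n)) (B : 'M[C]_(n, p)) :
  (A *m B)^t* = B^t* *m A^t*.
Proof. by rewrite trmx_mul map_mxM. Qed.

Lemma adjK m n (A : 'M[C]_(m, n)) : (A^t*)^t* = A.
Proof. by apply/matrixP => i j; rewrite !mxE conjCK. Qed.

Lemma adj_unitmx n (A : 'M[C]_n) : (A^t* \in unitmx) = (A \in unitmx).
Proof. by rewrite map_unitmx unitmx_tr. Qed.

Lemma frobN m n (A : 'M[C]_(m, n)) : frob (- A) = frob A.
Proof.
apply: eq_bigr => i _; apply: eq_bigr => j _.
by rewrite mxE -mulN1r nsqM /nsq/= oppr0 expr0n addr0 sqrrN expr1n mul1r.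
Qed.

Lemma frob1 n : frob (1%:M : 'M[C]_n) = n%:R.
Proof.
rewrite /frob (eq_bigr (fun=> 1)) ?sumr_const ?card_ord// => i _.
rewrite (bigD1 i)//= mxE eqxx nsq1 big1 ?addr0// => j ji.
by rewrite mxE eq_sym (negbTE ji) nsq0.
Qed.

Lemma sqnormB m (u v : 'cV[C]_m) :
  sqnorm (u - v) = sqnorm u - 2 * complex.Re ((v^t* *m u) 0 0) + sqnorm v.
Proof.
rewrite !sqnormE mxE raddf_sum mulr_sumr -sumrN -!big_split/=.
apply: eq_bigr => i _; rewrite !mxE.
by case: (u i 0) (v i 0) => u1 u2 [v1 v2]; rewrite /nsq/=; ring.
Qed.

Lemma sqnorm_mul m n (J : 'M[C]_(m, n)) (x : 'cV[C]_n) :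
  complex.Re ((x^t* *m (J^t* *m J) *m x) 0 0) = sqnorm (J *m x).
Proof. by rewrite /sqnorm adjM !mulmxA. Qed.

Context (M N : nat) (Es : R).
Hypothesis Es_gt0 : 0 < Es.

(** The term x^* x / Es of the model cancels the exponent of the prior, leaving a Gaussian governed
    by J alone. The [+ 0] matches the affine form of the integral lemmas. *)
Lemma pm_cond_pdfE (F : 'M[C]_(M, N)) (J : 'M[C]_N) (y : 'cV[C]_M)
    (x : 'cV[C]_N) :
  pm_cond Es F (J^t* *m J) y x * cn_pdf Es x =
  (pi * Es) ^- N * expR (2 * complex.Re ((y^t* *m F *m x) 0 0) -
                         sqnorm (J *m x + 0)).
Proof.
rewrite cn_pdfE// /pm_cond sqnorm_mul addr0 mulrCA -expRD.
by congr (_ * expR _); ring.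
Qed.

Lemma piEs_gt0 : 0 < (pi * Es) ^+ N.
Proof. by rewrite exprn_gt0// mulr_gt0 ?pi_gt0. Qed.

Lemma pm_singular (F : 'M[C]_(M, N)) (J : 'M[C]_N) (y : 'cV[C]_M) :
  is_trig_mx J -> \det J = 0 -> pm Es F (J^t* *m J) y = +oo%E.
Proof.
move=> tJ dJ; rewrite /pm; under eq_integral do rewrite pm_cond_pdfE.
rewrite ge0_integralZlR ?expR_ge0//; last 2 first.
- by rewrite invr_ge0 ltW// piEs_gt0.
- exact: measurable_gauss_cvec.
rewrite integral_gauss_cvec_singular// gt0_muley// lte_fin invr_gt0.
exact: piEs_gt0.
Qed.

Lemma pm_regular (F : 'M[C]_(M, N)) (J : 'M[C]_N) (y : 'cV[C]_M) :
  is_trig_mx J -> \det J != 0 ->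
  pm Es F (J^t* *m J) y = ((Es ^+ N * nsq (\det J))^-1 *
    expR (sqnorm ((invmx J)^t* *m F^t* *m y)))%:E.
Proof.
move=> tJ dJ; rewrite /pm; under eq_integral do rewrite pm_cond_pdfE.
have uJ : J \in unitmx by rewrite unitmxE unitfE.
rewrite ge0_integralZlR ?expR_ge0//; last 2 first.
- by rewrite invr_ge0 ltW// piEs_gt0.
- exact: measurable_gauss_cvec.
pose u := y^t* *m F *m invmx J.
have <- : u *m J = y^t* *m F by rewrite mulmxKV.
rewrite integral_gauss_linear_cvec// -EFinM mulmx0 mxE mulr0 subr0.
have -> : u^t* = (invmx J)^t* *m F^t* *m y by rewrite !adjM adjK mulmxA.
rewrite mulrA; congr (_ * _)%:E; rewrite exprMn; field.
by rewrite nsq_eq0 dJ !expf_neq0 ?gt_eqF ?pi_gt0.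
Qed.

(** The choice of K gives K^* J = F, so that y^* F x is the cross term of |J x - K y|^2. *)
Lemma ln_pm_cond (F : 'M[C]_(M, N)) (J : 'M[C]_N) (y : 'cV[C]_M)
    (x : 'cV[C]_N) : J \in unitmx ->
  let K := (invmx J)^t* *m F^t* in
  ln (pm_cond Es F (J^t* *m J) y x) =
  - 1 * sqnorm (J *m x - K *m y) + (sqnorm (K *m y) + Es^-1 * sqnorm x).
Proof.
move=> uJ K; rewrite expRK sqnorm_mul sqnormB.
have -> : (K *m y)^t* *m (J *m x) = y^t* *m F *m x.
  by rewrite !adjM !adjK !mulmxA mulmxKV.
ring.
Qed.

Context d (T : measurableType d) (P : probability T R) (N0 : R)
  (X : {RV P >-> cvec R N}) (W : {RV P >-> cvec R M}) (H : 'M[C]_(M, N)).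
Hypotheses (N0_gt0 : 0 < N0) (XE : is_CN Es X) (WE : is_CN N0 W)
  (XW : independent_rv X W).
Let Y : T -> cvec R M := fun w => H *m X w + W w.

Let has_mean_sqnorm p (A : 'M[C]_(p, N)) (B : 'M[C]_(p, M)) :
  has_mean P (fun w => sqnorm (A *m X w + B *m W w))
    (Es * frob A + N0 * frob B).
Proof.
split; first exact: (integrable_sqnorm_joint_CN Es_gt0 N0_gt0).
exact: integral_sqnorm_joint_CN.
Qed.

(** In [\bar R] subtracting +oo always yields -oo, whatever the first expectation is. *)
Lemma I_LB_singular (F : 'M[C]_(M, N)) (J : 'M[C]_N) :
  is_trig_mx J -> \det J = 0 -> I_LB Es F (J^t* *m J) P X Y = -oo%E.
Proof.
move=> tJ dJ; rewrite /I_LB.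
under [X in (_ - X)%E]eq_integral do rewrite pm_singular//=.
rewrite [X in (_ - X)%E](_ : _ = +oo * P setT)%E; last exact: integral_cst.
by rewrite probability_setT mule1 addeNy.
Qed.

(** E |K y|^2 occurs in both expectations and cancels. E |x|^2 / Es contributes N, the constant
    factor of [pm] contributes N ln Es + ln |det J|^2, and J x - K y = (J - K H) x - K n gives the
    mean square error. *)
Lemma I_LB_regular (F : 'M[C]_(M, N)) (J : 'M[C]_N) :
  is_trig_mx J -> \det J != 0 ->
  let K := (invmx J)^t* *m F^t* in
  I_LB Es F (J^t* *m J) P X Y =
  (N%:R + N%:R * ln Es + ln (nsq (\det J)) -
   (Es * frob (J - K *m H) + N0 * frob K))%:E.
Proof.
move=> tJ dJ K; have uJ : J \in unitmx by rewrite unitmxE unitfE.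
have d0 : 0 < nsq (\det J) by rewrite nsq_gt0.
have q1 : has_mean P (fun w => sqnorm (J *m X w - K *m Y w))
    (Es * frob (J - K *m H) + N0 * frob K).
  rewrite -(frobN K); have := has_mean_sqnorm (J - K *m H) (- K).
  congr has_mean; apply/funext => w; congr sqnorm.
  by rewrite /Y mulmxDr mulmxBl mulNmx opprD addrA mulmxA.
have q2 : has_mean P (fun w => sqnorm (K *m Y w))
    (Es * frob (K *m H) + N0 * frob K).
  have := has_mean_sqnorm (K *m H) K.
  by congr has_mean; apply/funext => w; rewrite /Y mulmxDr mulmxA.
have q3 : has_mean P (fun w => sqnorm (X w)) (Es * N%:R).
  have := has_mean_sqnorm 1%:M (0 : 'M[C]_(N, M)).
  rewrite frob1 (_ : frob 0 = 0) ?mulr0 ?addr0.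
    by congr has_mean; apply/funext => w; rewrite mul0mx addr0 mul1mx.
  by rewrite /frob big1// => i _; rewrite big1// => j _; rewrite mxE nsq0.
pose lc := ln (Es ^+ N * nsq (\det J))^-1.
have c0 : 0 < (Es ^+ N * nsq (\det J))^-1 by rewrite invr_gt0 mulr_gt0// exprn_gt0.
rewrite /I_LB.
under eq_integral do rewrite ln_pm_cond//.
under [X in (_ - X)%E]eq_integral do
  rewrite pm_regular// lne_EFin ?mulr_gt0 ?expR_gt0// lnM ?posrE ?expR_gt0// expRK.
have [_ ->] := has_meanD (has_meanZ (- 1) q1) (has_meanD q2 (has_meanZ Es^-1 q3)).
have [_ ->] := has_meanD (has_mean_cst P lc) q2.
rewrite -EFinB /lc lnV ?posrE ?mulr_gt0 ?exprn_gt0//.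
rewrite lnM ?posrE ?exprn_gt0// lnXn//; congr EFin.
by rewrite mulKf ?gt_eqF// -mulr_natl; ring.
Qed.

End mutual_information_bound.

(** * Frobenius norms and the least mean square estimate *)

Section frobenius.
Context (R : realType).
Local Notation C := R[i].

(** The real inner product whose quadratic form is [frob]; the real part makes it symmetric. *)
Definition mxip m n (A B : 'M[C]_(m, n)) : R := complex.Re (\tr (A *m B^t*)).

Let ReD (z w : C) : complex.Re (z + w) = complex.Re z + complex.Re w.
Proof. by case: z w => ? ? []. Qed.

Let ReZ (a : R) (z : C) : complex.Re (a%:C * z) = a * complex.Re z.
Proof. by case: z => u v /=; rewrite mul0r subr0. Qed.

Lemma frobE m n (A : 'M[C]_(m, n)) : frob A = mxip A A.
Proof.
rewrite /mxip; suff -> : \tr (A *m A^t*) = (frob A)%:C by [].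
rewrite /frob rmorph_sum; apply: eq_bigr => i _; rewrite mxE rmorph_sum.
by apply: eq_bigr => j _; rewrite !mxE mulrC -nsqE.
Qed.

Lemma frob_ge0 m n (A : 'M[C]_(m, n)) : 0 <= frob A.
Proof. by rewrite sumr_ge0// => i _; rewrite sumr_ge0// => j _; exact: nsq_ge0. Qed.

Lemma frob_eq0 m n (A : 'M[C]_(m, n)) : frob A = 0 -> A = 0.
Proof.
move=> A0; apply/matrixP => i j; rewrite mxE; apply/eqP; rewrite -nsq_eq0.
have := A0; rewrite /frob => /eqP; rewrite psumr_eq0 => [/allP/(_ i)|k _]; last first.
  by rewrite sumr_ge0// => l _; exact: nsq_ge0.
rewrite mem_index_enum => /(_ isT)/=.
rewrite psumr_eq0 => [/allP/(_ j)|k _]; last exact: nsq_ge0.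
by rewrite mem_index_enum => /(_ isT).
Qed.

Lemma mxipDl m n (A B D : 'M[C]_(m, n)) : mxip (A + B) D = mxip A D + mxip B D.
Proof. by rewrite /mxip mulmxDl raddfD ReD. Qed.

Lemma mxipZl m n (a : R) (A B : 'M[C]_(m, n)) :
  mxip (a%:C *: A) B = a * mxip A B.
Proof. by rewrite /mxip -scalemxAl mxtraceZ ReZ. Qed.

Lemma mxipC m n (A B : 'M[C]_(m, n)) : mxip A B = mxip B A.
Proof.
rewrite /mxip -{1}(adjK A) -adjM.
have -> (D : 'M[C]_m) : \tr (D^t*) = Num.conj (\tr D).
  by rewrite rmorph_sum; apply: eq_bigr => i _; rewrite !mxE.
by case: (\tr _).
Qed.

Lemma mxip_adj m n p (A : 'M[C]_(m, n)) (B : 'M[C]_(m, p)) (D : 'M[C]_(p, n)) :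
  mxip A (B *m D) = mxip (A *m D^t*) B.
Proof. by rewrite /mxip adjM mulmxA. Qed.

Lemma frobD m n (A B : 'M[C]_(m, n)) :
  frob (A + B) = frob A + 2 * mxip A B + frob B.
Proof.
by rewrite !frobE mxipDl ![mxip _ (A + B)]mxipC !mxipDl [mxip B A]mxipC; ring.
Qed.

Lemma frobZ m n (a : R) (A : 'M[C]_(m, n)) : frob (a%:C *: A) = a ^+ 2 * frob A.
Proof. by rewrite !frobE mxipZl mxipC mxipZl; ring. Qed.

Lemma frob_block m1 m2 n1 n2 (A : 'M[C]_(m1, n1)) (B : 'M[C]_(m1, n2))
    (D : 'M[C]_(m2, n1)) (E : 'M[C]_(m2, n2)) :
  frob (block_mx A B D E) = frob A + frob B + frob D + frob E.
Proof.
rewrite /frob big_split_ord/= -!addrA addrA -!big_split/=.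
by congr (_ + _); apply: eq_bigr => i _; rewrite big_split_ord/=; congr (_ + _);
  apply: eq_bigr => j _; rewrite ?block_mxEul ?block_mxEur ?block_mxEdl ?block_mxEdr.
Qed.

Lemma frob_diag n (A : 'M[C]_n) : is_diag_mx A -> frob A = \sum_i nsq (A i i).
Proof.
move=> /is_diag_mxP dA; apply: eq_bigr => i _.
rewrite (bigD1 i)//= big1 ?addr0// => j ji.
by rewrite dA ?nsq0// eq_sym.
Qed.

(* The linear estimate of J x from y = H x + n with the least mean square
   error is [N0^-1 U H^*] with [U = J (L^* L)^-1]; the remainder measures the
   distance of K from it. *)
Lemma regression_frob (M N p : nat) (Es N0 : R) (H : 'M[C]_(M, N))
    (L : 'M[C]_N) (U : 'M[C]_(p, N)) (K : 'M[C]_(p, M)) :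
  Es != 0 -> N0 != 0 ->
  L^t* *m L = (N0^-1)%:C *: (H^t* *m H) + (Es^-1)%:C *: 1%:M ->
  let D := K - (N0^-1)%:C *: (U *m H^t*) in
  Es * frob (U *m (L^t* *m L) - K *m H) + N0 * frob K =
  frob (U *m L^t*) + (Es * frob (D *m H) + N0 * frob D).
Proof.
move=> Es0 N00 LE D.
have KE : K = D + (N0^-1)%:C *: (U *m H^t*) by rewrite /D subrK.
(* The optimal part of K removes N0^-1 U H^* H from U L^* L, which leaves Es^-1 U. *)
have -> : U *m (L^t* *m L) - K *m H = (Es^-1)%:C *: U - D *m H.
  rewrite KE LE mulmxDr mulmxDl -!scalemxAr mulmx1 -scalemxAl mulmxA.
  by rewrite [D *m H + _]addrC opprD addrACA subrr add0r.
have -> : frob (U *m L^t*) = N0^-1 * frob (U *m H^t*) + Es^-1 * frob U.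
  rewrite frobE mxip_adj adjK -mulmxA LE mulmxDr mxipDl -!scalemxAr !mxipZl mulmx1.
  have := mxip_adj (U *m H^t*) U (H^t*); rewrite adjK mulmxA => <-.
  by rewrite -!frobE.
rewrite frobD frobN frobZ mxipZl.
have -> : mxip U (- (D *m H)) = - mxip U (D *m H).
  by rewrite -[- _]scale1r scalerN -scaleNr -(rmorph1 (real_complex R))
             -rmorphN mxipC mxipZl mulN1r mxipC.
(* The cross terms - 2 <U, D H> and 2 <U H^*, D> cancel by adjunction, so D contributes its squares
   only. *)
rewrite [in N0 * _]KE frobD frobZ [mxip D _]mxipC mxipZl mxip_adj.
by field; rewrite Es0 N00.
Qed.

Lemma ln_le_subr1 (x : R) : 0 < x -> ln x - x <= - 1 ?= iff (x == 1).
Proof.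
move=> x0; have [->|x1] := eqVneq x 1; first by rewrite ln1 sub0r; exact/leif_refl.
have := @expR_gt1Dx R (ln x); rewrite lnK ?posrE// ln_eq0// => /(_ x1) h.
split; first lra.
by apply/negbTE; rewrite lt_eqF//; lra.
Qed.

Lemma ln_prod (I : Type) (r : seq I) (f : I -> R) : (forall i, 0 < f i) ->
  ln (\prod_(i <- r) f i) = \sum_(i <- r) ln (f i).
Proof.
move=> f0; elim: r => [|i r IH]; first by rewrite !big_nil ln1.
by rewrite !big_cons lnM ?posrE ?IH// prodr_gt0.
Qed.

Lemma nsq_prod (I : Type) (r : seq I) (f : I -> C) :
  nsq (\prod_(i <- r) f i) = \prod_(i <- r) nsq (f i).
Proof. by apply: (big_morph _ (@nsqM R) (@nsq1 R)). Qed.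

(* Hadamard's inequality in logarithmic form. *)
Lemma ln_det_trig_le n (B : 'M[C]_n) : is_trig_mx B -> \det B != 0 ->
  ln (nsq (\det B)) - frob B <= - n%:R /\
  (ln (nsq (\det B)) - frob B = - n%:R -> B^t* *m B = 1%:M).
Proof.
move=> tB; rewrite (det_trig tB) => /prodf_neq0 b0.
have d0 i : 0 < nsq (B i i) by rewrite nsq_gt0 b0.
pose off := \sum_i \sum_(j | j != i) nsq (B i j).
have off_i_ge0 i : 0 <= \sum_(j | j != i) nsq (B i j).
  by rewrite sumr_ge0// => j _; exact: nsq_ge0.
have off_ge0 : 0 <= off by rewrite sumr_ge0.
have frobB : frob B = \sum_i nsq (B i i) + off.
  by rewrite -big_split/=; apply: eq_bigr => i _; rewrite (bigD1 i).
have n1 : - n%:R = \sum_(i < n) (- 1 : R).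
  by rewrite sumr_const card_ord mulNrn.
rewrite nsq_prod ln_prod// frobB opprD addrA -sumrB n1.
have diag_le : \sum_(i < n) (ln (nsq (B i i)) - nsq (B i i)) <= \sum_(i < n) (- 1).
  by apply: ler_sum => i _; exact: (ln_le_subr1 (d0 i)).
split=> [|E]; first by rewrite -[leRHS]subr0 lerB.
(* The off-diagonal loss and the diagonal losses t - 1 - ln t, with t = |B_ii|^2, are all
   nonnegative, so equality makes each of them vanish. *)
have off0 : off = 0 by lra.
have diag1 i : nsq (B i i) = 1.
  have : \sum_(i < n) (- 1 - (ln (nsq (B i i)) - nsq (B i i))) == 0.
    by rewrite sumrB subr_eq0; apply/eqP; lra.
  rewrite psumr_eq0 => [/allP/(_ i)|j _].
    rewrite mem_index_enum => /(_ isT)/=; rewrite subr_eq0 eq_sym.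
    by rewrite (ln_le_subr1 (d0 i)) => /eqP.
  by rewrite subr_ge0 (ln_le_subr1 (d0 j)).
have offE i j : i != j -> B i j = 0.
  move=> ij; apply/eqP; rewrite -nsq_eq0; move/eqP: off0.
  rewrite psumr_eq0// => /allP/(_ i); rewrite mem_index_enum => /(_ isT)/=.
  rewrite psumr_eq0 => [/allP/(_ j)|k _]; last exact: nsq_ge0.
  by rewrite mem_index_enum eq_sym ij => /(_ isT).
apply/matrixP => i j; rewrite !mxE (bigD1 j)//= big1 => [|l lj]; last first.
  by rewrite [B l j]offE ?mulr0.
rewrite !mxE addr0; have [->|ij] := eqVneq i j.
  by rewrite -nsqE diag1.
by rewrite offE ?(eq_sym j)// rmorph0 mul0r.
Qed.

(** Push-through identity: (L^* L) H^* = N0^-1 H^* (H H^* + alpha 1) with alpha = N0 / Es, and both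
    outer factors are inverted. The new form is the optimal estimator of [regression_frob]. *)
Lemma mmse_filterE (M N : nat) (H : 'M[C]_(M, N)) (Es N0 : R) (L : 'M[C]_N) :
  0 < Es -> 0 < N0 -> L \in unitmx ->
  L^t* *m L = (N0^-1)%:C *: (H^t* *m H) + (Es^-1)%:C *: 1%:M ->
  mmse_filter H (N0 / Es) = (N0^-1)%:C *: (invmx (L^t* *m L) *m H^t*).
Proof.
move=> Es0 N00 uL LE; rewrite /mmse_filter; set A := _ + _.
have uLL : L^t* *m L \in unitmx by rewrite unitmx_mul adj_unitmx uL.
have uA : A \in unitmx.
  (* H H^* + alpha 1 is positive definite: v A = 0 gives |v H|^2 + alpha |v|^2 = 0. *)
  rewrite -row_free_unit; apply: inj_row_free => v vA; apply: frob_eq0.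
  have a0 : 0 < N0 / Es by rewrite divr_gt0.
  have : mxip (v *m A) v = 0 by rewrite vA /mxip mul0mx mxtrace0.
  rewrite mulmxDr mxipDl mul_mx_scalar mxipZl mulmxA -mxip_adj -!frobE.
  move=> /eqP; rewrite paddr_eq0 ?frob_ge0//; last first.
    by rewrite mulr_ge0 ?frob_ge0// ltW.
  by rewrite mulf_eq0 (gt_eqF a0) => /andP[_ /eqP].
have HA : (L^t* *m L) *m H^t* = (N0^-1)%:C *: (H^t* *m A).
  rewrite LE /A mulmxDl mulmxDr scalerDr -!scalemxAl mul1mx mulmxA.
  rewrite mul_mx_scalar scalerA -rmorphM/=; congr (_ + _%:C *: _).
  by field; rewrite !gt_eqF.
have HE : H^t* = (N0^-1)%:C *: (invmx (L^t* *m L) *m (H^t* *m A)).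
  by rewrite scalemxAr -HA mulKmx.
apply: (can_inj (mulmxK uA)); rewrite (mulmxKV uA) -scalemxAl -mulmxA.
exact: HE.
Qed.

End frobenius.

(** * The punctured factor *)

Section punctured_matrices.
Context (R : realType) (nu k : nat).
Local Notation C := R[i].
Implicit Types J L B : 'M[C]_(nu + k).

Lemma punctured_trig J : punctured J -> is_trig_mx J.
Proof.
move=> [J1 [J2 [J3 [t1 d3 _ ->]]]].
by rewrite is_trig_block_mx// eqxx t1 is_diag_mx_is_trig.
Qed.

(** Columns of B are settled from the last to the first: as P is lower triangular, entry (i, j) of B
    P involves only B_il with l >= j, and for i < j < l these vanish by induction. *)
Lemma trig_mx_divr n (B P : 'M[C]_n) : is_trig_mx (B *m P) -> is_trig_mx P ->
  (forall i, P i i != 0) -> is_trig_mx B.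
Proof.
move=> /is_trig_mxP tBP /is_trig_mxP tP P0.
suff H m (i j : 'I_n) : (n - j <= m)%N -> (i < j)%N -> B i j = 0.
  by apply/is_trig_mxP => i j; exact: (H (n - j)%N).
elim: m i j => [|m IH] i j; first by rewrite leqn0 subn_eq0 leqNgt ltn_ord.
move=> nj ij; have := tBP i j ij.
rewrite mxE (bigD1 j)//= big1 ?addr0 => [/eqP|l lj].
  by rewrite mulf_eq0 (negbTE (P0 j)) orbF => /eqP.
have [jl|jl] := ltnP j l; last by rewrite tP ?mulr0// ltn_neqAle lj jl.
rewrite IH ?mul0r// ?(ltn_trans ij)//.
by have := ltn_ord l; lia.
Qed.

Lemma nsq_sqrtC (x : R) : 0 <= x -> nsq (sqrtC x%:C) = x.
Proof.
move=> x0; apply: complexI; rewrite nsqE mulrC -normCK ger0_norm ?sqrtC_ge0 ?ler0c//.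
exact: sqrtCK.
Qed.

(** Entry (i, i) of V V^*, with V = S^-1, is the squared norm of row i of V, nonzero as V is
    invertible. Hence Omega scales the rows of S^-1 to unit norm; realness is the condition imposed
    on J_3. *)
Lemma diag_invsqrtE (S : 'M[C]_k) i : S \in unitmx ->
  [/\ 0 < \sum_j nsq (invmx S i j),
      nsq (diag_invsqrt (invmx S *m (invmx S)^t*) i i) =
        (\sum_j nsq (invmx S i j))^-1
    & diag_invsqrt (invmx S *m (invmx S)^t*) i i \is Num.real].
Proof.
move=> uS; set V := invmx S; set s := \sum_j _.
have VE : (V *m V^t*) i i = s%:C.
  by rewrite mxE rmorph_sum; apply: eq_bigr => j _; rewrite !mxE mulrC -nsqE.
have s_ge0 : 0 <= s by rewrite sumr_ge0// => j _; exact: nsq_ge0.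
have s_gt0 : 0 < s.
  rewrite lt0r s_ge0 andbT; apply/eqP => s0.
  have V0 j : V i j = 0.
    move/eqP: s0; rewrite psumr_eq0 => [/allP/(_ j)|l _]; last exact: nsq_ge0.
    by rewrite mem_index_enum => /(_ isT)/=; rewrite nsq_eq0 => /eqP.
  have : (V *m S) i i = 0 by rewrite mxE big1// => j _; rewrite V0 mul0r.
  by rewrite mulVmx// mxE eqxx => /eqP; rewrite oner_eq0.
have OE : diag_invsqrt (V *m V^t*) i i = (sqrtC s%:C)^-1.
  by rewrite /diag_invsqrt [LHS]mxE eqxx mulr1n [LHS]mxE VE.
split => //; rewrite OE.
  have : nsq (sqrtC s%:C) * nsq (sqrtC s%:C)^-1 = 1.
    by rewrite -nsqM divff ?nsq1// sqrtC_eq0 -nsq_eq0 /nsq/= expr0n addr0 sqrf_eq0 gt_eqF.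
  rewrite nsq_sqrtC// => /(congr1 ( *%R s^-1)).
  by rewrite mulKf ?gt_eqF// mulr1.
by rewrite ger0_real// invr_ge0 sqrtC_ge0 ler0c.
Qed.

Section optimum.
Context (L : 'M[C]_(nu + k)).
Hypotheses (tL : is_trig_mx L) (L_gt0 : forall i, 0 < L i i).

Let Pa := ulsubmx L.
Let Ra := dlsubmx L.
Let S := drsubmx L.
Let Om := diag_invsqrt (invmx S *m (invmx S)^t*).

Let LE : L = block_mx Pa 0 Ra S.
Proof.
move: tL; rewrite -{1}(submxK L) is_trig_block_mx// => /and3P[/eqP ur0 _ _].
by rewrite -{1}(submxK L) ur0.
Qed.

Lemma trig_pos_unitmx : L \in unitmx.
Proof.
rewrite unitmxE unitfE (det_trig tL); apply/prodf_neq0 => i _.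
by rewrite gt_eqF.
Qed.

Let uPS : Pa \in unitmx /\ S \in unitmx.
Proof.
have := trig_pos_unitmx; rewrite {1}LE unitmxE det_lblock unitrM.
by rewrite -!unitmxE => /andP.
Qed.

Let dOm : is_diag_mx Om.
Proof. exact: diag_mx_is_diag. Qed.

Let uOm : Om \in unitmx.
Proof.
rewrite unitmxE unitfE det_trig ?is_diag_mx_is_trig//; apply/prodf_neq0 => i _.
have [s0 OE _] := diag_invsqrtE i uPS.2.
by rewrite -nsq_eq0 OE invr_eq0 gt_eqF.
Qed.

Lemma punctured_augmented_punctured : punctured (punctured_augmented L).
Proof.
exists Pa, (Om *m invmx S *m Ra), Om; split => //.
  by move: tL; rewrite -{1}(submxK L) is_trig_block_mx// => /and3P[].
apply/mxOverP => i j; have [->|ij] := eqVneq i j.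
  by have [] := diag_invsqrtE j uPS.2.
by move/is_diag_mxP: dOm => ->//; exact: real0.
Qed.

Lemma det_punctured_augmented_neq0 : \det (punctured_augmented L) != 0.
Proof.
have [uP _] := uPS; have := uOm.
by rewrite /punctured_augmented det_lblock mulf_eq0 negb_or -!unitfE -!unitmxE uP.
Qed.

(** B is J L_ap^-1. Its lower right block is J_3 Omega^-1, hence diagonal, and its product with the
    unit rows of Omega S^-1 keeps the Frobenius norm; the other blocks of J L^-1 and B coincide. *)
Lemma punctured_factor J : punctured J ->
  exists B, [/\ is_trig_mx B, J = B *m punctured_augmented L
    & frob (J *m invmx L) = frob B].
Proof.
move=> pJ; have [uP uS] := uPS; set Lap := punctured_augmented L.
have LapE : Lap = block_mx Pa 0 (Om *m invmx S *m Ra) Om by [].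
have uLap : Lap \in unitmx.
  by rewrite unitmxE unitfE; exact: det_punctured_augmented_neq0.
have tLap := punctured_trig punctured_augmented_punctured.
pose B := J *m invmx Lap; have JE : J = B *m Lap by rewrite mulmxKV.
have tB : is_trig_mx B.
  apply: (trig_mx_divr (P := Lap)) => [||i]; last 1 first.
  - move: det_punctured_augmented_neq0; rewrite (det_trig tLap).
    by move/prodf_neq0/(_ i isT).
  - by rewrite -JE; exact: punctured_trig.
  - exact: tLap.
exists B; split => //.
set B1 := ulsubmx B; set B2 := dlsubmx B; set B3 := drsubmx B.
have BE : B = block_mx B1 0 B2 B3.
  have := tB; rewrite -{1}(submxK B) is_trig_block_mx// => /and3P[/eqP ur0 _ _].
  by rewrite -{1}(submxK B) ur0.
have dB3 : is_diag_mx B3.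
  have [J1 [J2 [J3 [_ d3 _ J_E]]]] := pJ.
  have J3E : B3 *m Om = J3.
    move: JE; rewrite BE LapE mulmx_block J_E => /(congr1 (@drsubmx _ _ _ _ _)).
    by rewrite !block_mxKdr mulmx0 add0r.
  apply/is_diag_mxP => i j ij; have [s0 OE _] := diag_invsqrtE j uS.
  have : B3 i j * Om j j = 0.
    have <- : (B3 *m Om) i j = B3 i j * Om j j.
      rewrite /Om /diag_invsqrt mul_mx_diag [LHS]mxE; congr (_ * _).
      by rewrite [RHS]mxE eqxx mulr1n.
    by rewrite J3E; move/is_diag_mxP: d3 => ->.
  move=> /eqP; rewrite mulf_eq0 -[Om j j == 0]nsq_eq0 OE invr_eq0 (gt_eqF s0) orbF.
  by move=> /eqP.
(* L_ap arises from L by multiplying the lower block row by Omega S^-1, so this factor is all that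
   L^-1 leaves. *)
have TE : Lap *m invmx L = block_mx 1%:M 0 0 (Om *m invmx S).
  apply: (can_inj (mulmxK trig_pos_unitmx)); rewrite mulmxKV ?trig_pos_unitmx//.
  rewrite [in RHS]LE mulmx_block !mul1mx !mul0mx !addr0 !add0r mulmxKV//.
rewrite JE -mulmxA TE {1}BE mulmx_block !mulmx1 !mulmx0 !mul0mx !addr0 !add0r.
rewrite frob_block [in RHS]BE frob_block; congr (_ + _).
rewrite (frob_diag dB3); apply: eq_bigr => i _.
have [s0 OE _] := diag_invsqrtE i uS.
transitivity (\sum_j nsq (B3 i i) * (nsq (Om i i) * nsq (invmx S i j))).
  apply: eq_bigr => j _; rewrite -!nsqM; congr nsq.
  rewrite mxE (bigD1 i)//= big1 ?addr0 => [|l li].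
    congr (_ * _); rewrite mxE (bigD1 i)//= big1 ?addr0// => l li.
    by move/is_diag_mxP: dOm => ->; rewrite ?mul0r// eq_sym.
  by move/is_diag_mxP: dB3 => ->; rewrite ?mul0r// eq_sym.
by rewrite -!mulr_sumr OE mulVf ?gt_eqF// mulr1.
Qed.

End optimum.
End punctured_matrices.

(** * Gram matrices and the comparison with the optimum *)

Section quadratic_gram.
Context (R : realType).
Local Notation C := R[i].

Lemma psdmx_gram n (J : 'M[C]_n) : psdmx (J^t* *m J).
Proof.
split.
  by rewrite qualifE expr0 scale1r adjM adjK.
move=> x; have -> : (x^t* *m (J^t* *m J) *m x) 0 0 = (sqnorm (J *m x))%:C.
  by rewrite sqnormEC adjM !mulmxA.
by rewrite ler0c sqnorm_ge0.
Qed.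

Lemma det_gram n (J : 'M[C]_n) : \det (J^t* *m J) = (nsq (\det J))%:C.
Proof. by rewrite det_mulmx det_map_mx det_tr nsqE. Qed.

(** Q^* Q = 1 removes Q from the Gram matrix of the augmented matrix, whose two blocks then add up.
    The result is the inverse error covariance of the MMSE estimate of x, which is why |J L_a^-1|^2
    is the least mean square error for J x. *)
Lemma augmented_gram (M N : nat) (H : 'M[C]_(M, N)) (Es N0 : R)
    (Q : 'M[C]_(M + N, N)) (L : 'M[C]_N) : 0 < Es -> 0 < N0 ->
  thin_QL (augmented_mx H Es N0) Q L ->
  L^t* *m L = (N0^-1)%:C *: (H^t* *m H) + (Es^-1)%:C *: 1%:M.
Proof.
move=> Es0 N00 [AE QQ _ _].
have <- : (augmented_mx H Es N0)^t* *m augmented_mx H Es N0 = L^t* *m L.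
  by rewrite AE adjM -mulmxA [Q^t* *m _]mulmxA QQ mul1mx.
have adjZ m n (r : R) (A : 'M[C]_(m, n)) : (r%:C *: A)^t* = r%:C *: A^t*.
  by apply/matrixP => i j; rewrite !mxE rmorphM; congr (_ * _); exact: conjc_real.
have gramZ m n (r : R) (A : 'M[C]_(m, n)) :
    (r%:C *: A)^t* *m (r%:C *: A) = (r ^+ 2)%:C *: (A^t* *m A).
  by rewrite adjZ -scalemxAl -scalemxAr scalerA -rmorphM.
have sqV (r : R) : 0 < r -> (Num.sqrt r)^-1 ^+ 2 = r^-1.
  by move=> r0; rewrite exprVn sqr_sqrtr// ltW.
rewrite /augmented_mx tr_col_mx map_row_mx mul_row_col.
rewrite (gramZ _ _ _ H).
rewrite (gramZ _ _ _ 1%:M).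
rewrite (sqV _ N00) (sqV _ Es0).
by rewrite trmx1 map_mx1 mulmx1.
Qed.

End quadratic_gram.

(** Scalar form of the final comparison: e = N ln Es, j = ln |det L_ap|^2, n = N, b = ln |det B|^2,
    f = |B|^2, and r is the remainder of F. The gap is (f - b - n) + r. *)
Lemma gap_le (R : realFieldType) (e j n b f r : R) :
  b - f <= - n -> 0 <= r ->
  n + e + (b + j) - (f + r) <= e + j /\
  (n + e + (b + j) - (f + r) = e + j -> r = 0 /\ b - f = - n).
Proof. by move=> bf r0; split=> [|E]; [lra|split; lra]. Qed.

Theorem theorem3 (R : realType) (M nu k : nat) (H : 'M[R[i]]_(M, nu + k))
    (Es N0 : R) (d : measure_display) (T : measurableType d)
    (P : probability T R)
    (X : {RV P >-> cvec R (nu + k)}) (W : {RV P >-> cvec R M})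
    (Qa : 'M[R[i]]_(M + (nu + k), nu + k)) (La : 'M[R[i]]_(nu + k)) :
  (nu + k <= M)%N -> (0 < nu)%N -> (0 < k)%N -> 0 < Es -> 0 < N0 ->
  is_CN Es X -> is_CN N0 W -> independent_rv X W ->
  thin_QL (augmented_mx H Es N0) Qa La ->
  let Y : T -> cvec R M := fun w => H *m X w + W w in
  let ILB (F : 'M[R[i]]_(M, nu + k)) (G : 'M[R[i]]_(nu + k)) : \bar R :=
    I_LB Es F G P X Y in
  let Jopt := punctured_augmented La in
  let Gopt := Jopt^t* *m Jopt in
  let Fopt := (mmse_filter H (N0 / Es))^t* *m Gopt in
  [/\ punctured Jopt,
      feasible Gopt,
      forall F G, feasible G -> (ILB F G <= ILB Fopt Gopt)%E,
      forall F G, feasible G -> ILB F G = ILB Fopt Gopt ->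
        F = Fopt /\ G = Gopt
    & ILB Fopt Gopt =
        ((nu + k)%:R * ln Es + ln (complex.Re (\det (Jopt^t* *m Jopt))))%:E].
Proof.
move=> _ _ _ Es0 N00 XE WE XW QL Y ILB Jopt Gopt Fopt.
have LLE := augmented_gram Es0 N00 QL.
have [_ _ tL L_gt0] := QL.
have uL := trig_pos_unitmx tL L_gt0.
have pJ := punctured_augmented_punctured tL L_gt0.
have dJ := det_punctured_augmented_neq0 tL L_gt0.
have fac := @punctured_factor _ _ _ _ tL L_gt0.
rewrite -/Jopt in pJ dJ fac; clearbody Jopt.
have uLL : La^t* *m La \in unitmx by rewrite unitmx_mul adj_unitmx uL.
set Mm := mmse_filter H (N0 / Es) in Fopt *.
have MmE : Mm = (N0^-1)%:C *: (invmx (La^t* *m La) *m H^t*).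
  exact: mmse_filterE.
clearbody Mm.
(* D compares the estimator J^-* F^* attached to F with the optimal J M. *)
pose rem F J := let D := (invmx J)^t* *m F^t* - J *m Mm in
  Es * frob (D *m H) + N0 * frob D.
have rem_ge0 F J : 0 <= rem F J.
  by rewrite addr_ge0// mulr_ge0 ?frob_ge0// ltW.
have ILBE F J : punctured J -> \det J != 0 -> ILB F (J^t* *m J) =
    ((nu + k)%:R + (nu + k)%:R * ln Es + ln (nsq (\det J)) -
     (frob (J *m invmx La) + rem F J))%:E.
  move=> pJ' dJ'; rewrite /ILB (I_LB_regular Es0 H N00)//; last exact: punctured_trig.
  congr (_ - _)%:E; set K := _ *m F^t*; pose U := J *m invmx (La^t* *m La).
  have := regression_frob U K (lt0r_neq0 Es0) (lt0r_neq0 N00) LLE.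
  rewrite /= {1}/U mulmxKV// => ->; congr (_ + _).
    (* U L^* = J L_a^-1, checked after multiplying by L_a on the right. *)
    congr frob; apply: (can_inj (mulmxK uL)).
    by rewrite mulmxKV// -mulmxA /U mulmxKV.
  have -> : (N0^-1)%:C *: (U *m H^t*) = J *m Mm by rewrite MmE -scalemxAr mulmxA.
  by [].
have GoptE : Gopt^t* = Gopt by rewrite /Gopt adjM adjK.
(* N0 |D|^2 = 0 forces D = 0, that is J^-* F^* = J M, and F is recovered as the adjoint of J^* J
   M. *)
have remE F J : \det J != 0 -> rem F J = 0 -> F = Mm^t* *m (J^t* *m J).
  move=> dJ' /eqP; rewrite paddr_eq0 ?mulr_ge0 ?frob_ge0 ?(ltW Es0) ?(ltW N00)//.
  rewrite !mulf_eq0 (gt_eqF N00) => /andP[_ /eqP/frob_eq0/eqP].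
  rewrite subr_eq0 => /eqP E.
  have uJ : J \in unitmx by rewrite unitmxE unitfE.
  rewrite -[LHS]adjK; have -> : F^t* = J^t* *m (J *m Mm).
    by rewrite -E mulmxA -adjM mulVmx// trmx1 map_mx1 mul1mx.
  by rewrite [LHS]adjM [(J *m Mm)^t*]adjM adjK mulmxA.
have rem_opt : rem Fopt Jopt = 0.
  have uJ : Jopt \in unitmx by rewrite unitmxE unitfE.
  rewrite /rem /Fopt adjM adjK GoptE /Gopt.
  have -> : (invmx Jopt)^t* *m (Jopt^t* *m Jopt *m Mm) - Jopt *m Mm = 0.
    by rewrite !mulmxA -adjM mulmxV// trmx1 map_mx1 mul1mx subrr.
  by rewrite mul0mx /frob !big1 ?mulr0 ?addr0// => i _; rewrite big1// => j _;
     rewrite mxE nsq0.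
(* For J = L_ap the factor B is 1, so |B|^2 = N cancels the summand N of I_LB. *)
have optE : ILB Fopt Gopt =
    ((nu + k)%:R * ln Es + ln (nsq (\det Jopt)))%:E.
  have [B [tB JB fB]] := fac _ pJ.
  have uJ : Jopt \in unitmx by rewrite unitmxE unitfE.
  have B1 : B = 1%:M by rewrite -(mulmxK uJ B) -JB mulmxV.
  by rewrite (ILBE _ _ pJ dJ) rem_opt fB B1 frob1; congr EFin; ring.
have ILB_sing F J : punctured J -> \det J = 0 -> ILB F (J^t* *m J) = -oo%E.
  by move=> pJ' dJ'; rewrite /ILB I_LB_singular//; exact: punctured_trig.
have key F J : punctured J -> \det J != 0 ->
    (ILB F (J^t* *m J) <= ILB Fopt Gopt)%E /\
    (ILB F (J^t* *m J) = ILB Fopt Gopt -> F = Fopt /\ J^t* *m J = Gopt).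
  move=> pJ' dJ'; have [B [tB JB fB]] := fac _ pJ'.
  have dB : \det B != 0.
    by move: dJ'; rewrite JB det_mulmx mulf_eq0 negb_or => /andP[].
  have lnE : ln (nsq (\det J)) = ln (nsq (\det B)) + ln (nsq (\det Jopt)).
    by rewrite JB det_mulmx nsqM lnM// posrE nsq_gt0.
  have [Ble Beq] := ln_det_trig_le tB dB.
  have [le_opt eq_opt] := gap_le ((nu + k)%:R * ln Es) (ln (nsq (\det Jopt)))
    Ble (rem_ge0 F J).
  rewrite (ILBE _ _ pJ' dJ') optE fB lnE lee_fin; split => // -[] /eq_opt[rem0 Bn].
  have GE : J^t* *m J = Gopt.
    by rewrite JB adjM -mulmxA [B^t* *m _]mulmxA (Beq Bn) mul1mx.
  by split => //; rewrite (remE _ _ dJ' rem0) GE.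
split; first exact: pJ.
- by split; [exact: psdmx_gram|exists Jopt].
- move=> F G [_ [J pJ' ->]]; have [dJ'|dJ'] := eqVneq (\det J) 0.
    by rewrite ILB_sing// leNye.
  by have [] := key F J pJ' dJ'.
- move=> F G [_ [J pJ' ->]]; have [dJ'|dJ'] := eqVneq (\det J) 0.
    (* The value -oo differs from the finite optimum, so a maximiser has invertible J. *)
    by rewrite ILB_sing// optE.
  by have [] := key F J pJ' dJ'.
- by rewrite optE det_gram.
Qed.
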